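(* For every $n\ge 2$ there exists a flexible cross-polytope $P_u$, $u\in\overline{\mathbb{R}}=\mathbb{R}\cup\{\infty\}$, in the sphere $\mathbb{S}^n$ possessing the following properties: (i) There is a $\delta>0$ such that the cross-polytope $P_u$ is embedded whenever $u\in(-\delta,\delta)$. (ii) $P_0$ is the equatorial great sphere $\mathbb{S}^{n-1}\subset\mathbb{S}^n$ with a decomposition into simplices combinatorially equivalent to the boundary of the $n$-dimensional cross-polytope. (iii) $P_u$ is contained in the upper hemisphere $\mathbb{S}^n_+$ whenever $u>0$, and is contained in the lower hemisphere $\mathbb{S}^n_-$ whenever $u<0$. (iv) $P_\infty$ is contained in the equatorial great sphere $\mathbb{S}^{n-1}$, but is not embedded.
   Context: $\mathbb{S}^n$ is the unit sphere in $\mathbb{R}^{n+1}$; a $k$-dimensional plane in $\mathbb{S}^n$ is a $k$-dimensional great sphere. Fix a unit vector $\mathbf{m}\in\mathbb{R}^{n+1}$; the equatorial great sphere is $\mathbb{S}^{n-1}=\{\mathbf{x}\in\mathbb{S}^n:\langle\mathbf{x},\mathbf{m}\rangle=0\}$, and $\mathbb{S}^n_{+}$, $\mathbb{S}^n_-$ are the open hemispheres $\langle\mathbf{x},\mathbf{m}\rangle>0$, $\langle\mathbf{x},\mathbf{m}\rangle<0$. In (iii), $u>0$ and $u<0$ refer to real $u$. $K_n$ is the simplicial complex with $2n$ vertices $\mathbf{a}_1,\dots,\mathbf{a}_n,\mathbf{b}_1,\dots,\mathbf{b}_n$ whose simplices are the sets of vertices containing no pair $\{\mathbf{a}_i,\mathbf{b}_i\}$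 (it is isomorphic to the boundary of the regular $n$-dimensional cross-polytope). A non-degenerate polyhedron of combinatorial type $K_n$ (a cross-polytope) in $\mathbb{S}^n$ is a mapping $P\colon K_n\to\mathbb{S}^n$ such that: (1) for each simplex $[v_0\dots v_l]$ of $K_n$ the points $P(v_0),\dots,P(v_l)$ are independent, i.e. do not lie in an $(l-1)$-dimensional plane, and the restriction of $P$ to $[v_0\dots v_l]$ is a homeomorphism onto the convex hull of these points; (2) $K_n$ cannot be decomposed into the union of two subcomplexes $K',K''$ of dimension $n-1$ such that $P(K'\cap K'')$ is contained in an $(n-2)$-dimensional plane. The particular homeomorphism chosen on each simplex is irrelevant: polyhedra with the same vertices are not distinguished. $P$ is embedded if the mapping $P$ is an embedding. ''$P$ is contained in a set'' means that $P(K_n)$ is. A flexible cross-polytope is a continuous family of mappings $P_u\colon K_n\to\mathbb{S}^n$ such that: (1) for all but a finite number of $u$, $P_u$ is a non-degenerate polyhedron of combinatorial type $K_n$; (2) the lengths of all edges of $P_u$ are constant as $u$ varies; (3) for any two sufficiently close to each other $u_1\neq u_2$, the polyhedra $P_{u_1}$ and $P_{u_2}$ are not congruent to each other. *)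

(* Defs.v *)
From HB Require Import structures.
From mathcomp Require Import all_boot all_order all_algebra.
From mathcomp Require Import all_classical all_reals all_analysis.

Set Implicit Arguments.
Unset Strict Implicit.
Unset Printing Implicit Defensive.

Import Order.TTheory GRing.Theory Num.Theory.
Import numFieldNormedType.Exports.

Local Open Scope classical_set_scope.
Local Open Scope ring_scope.

Definition homeomorphism_onto (S T : topologicalType) (A : set S) (B : set T)
    (f : S -> T) : Prop :=
  [/\ set_bij A B f, {within A, continuous f} &
      exists2 g : T -> S, {within B, continuous g} &
        forall x, A x -> g (f x) = x].

Definition dotp (R : realType) (d : nat) (x y : 'rV[R]_d) : R :=
  (x *m y^T) 0 0.

Definition sphere (R : realType) (n : nat) : set 'rV[R]_n.+1 :=
  [set x | dotp x x = 1].

Definition equator (R : realType) (n : nat) (m : 'rV[R]_n.+1) :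
    set 'rV[R]_n.+1 :=
  [set x | sphere x /\ dotp x m = 0].

Definition upper_hemisphere (R : realType) (n : nat) (m : 'rV[R]_n.+1) :
    set 'rV[R]_n.+1 :=
  [set x | sphere x /\ 0 < dotp x m].

Definition lower_hemisphere (R : realType) (n : nat) (m : 'rV[R]_n.+1) :
    set 'rV[R]_n.+1 :=
  [set x | sphere x /\ dotp x m < 0].

(* A k-dimensional plane of the sphere is its intersection with a linear
   subspace of dimension k + 1.  The argument [d] is k + 1, so that k = -1
   (the empty plane) is available as d = 0. *)
Definition in_plane (R : realType) (n d : nat) (A : set 'rV[R]_n.+1) : Prop :=
  exists U : {vspace 'rV[R]_n.+1},
    \dim U = d /\ A `<=` [set x | sphere x /\ x \in U].

Definition spherical_distance (R : realType) (n : nat) (x y : 'rV[R]_n.+1) : R :=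
  acos (dotp x y).

(* (i, 0) stands for the vertex a_i, and (i, 1) for b_i. *)
Definition vertex (n : nat) : finType := ('I_n * 'I_2)%type.

(* Abstract simplicial complexes contain the empty simplex; it has no points in
   the geometric realization. *)
Definition cross_complex (n : nat) : {set {set vertex n}} :=
  [set s : {set vertex n} | [forall i, ~~ (((i, 0) \in s) && ((i, 1) \in s))]].

Definition subcomplex (n : nat) (L : {set {set vertex n}}) : Prop :=
  L \subset cross_complex n /\
  forall s t : {set vertex n}, s \in L -> t \subset s -> t \in L.

Definition complex_dim (n : nat) (L : {set {set vertex n}}) : nat :=
  (\max_(s in L) #|s|).-1.

(* Points of the geometric realization are given by their barycentric
   coordinates, indexed by the vertices and arranged as an n x 2 matrix. *)
Definition vertex_point (R : realType) (n : nat) (v : vertex n) : 'M[R]_(n, 2) :=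
  delta_mx v.1 v.2.
Arguments vertex_point R {n} v.

Definition simplex (R : realType) (n : nat) (s : {set vertex n}) :
    set 'M[R]_(n, 2) :=
  [set x | [/\ forall v : vertex n, 0 <= x v.1 v.2,
               forall v : vertex n, v \notin s -> x v.1 v.2 = 0 &
               \sum_(v : vertex n) x v.1 v.2 = 1]].
Arguments simplex R {n} s.

Definition realization (R : realType) (n : nat) (L : {set {set vertex n}}) :
    set 'M[R]_(n, 2) :=
  [set x | exists2 s : {set vertex n}, s \in L & simplex R s x].
Arguments realization R {n} L.

Definition spherical_hull (R : realType) (n : nat) (s : {set vertex n})
    (p : vertex n -> 'rV[R]_n.+1) : set 'rV[R]_n.+1 :=
  [set x | sphere x /\
     exists2 c : vertex n -> R, (forall v, 0 <= c v) &
       x = \sum_(v in s) c v *: p v].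

(* A mapping K_n -> S^n is a total function on matrices, of which only the
   values on the realization of [cross_complex n] matter. *)
Definition vertices (R : realType) (n : nat)
    (P : 'M[R]_(n, 2) -> 'rV[R]_n.+1) : vertex n -> 'rV[R]_n.+1 :=
  fun v => P (vertex_point R v).

Definition body (R : realType) (n : nat)
    (P : 'M[R]_(n, 2) -> 'rV[R]_n.+1) :
    set 'rV[R]_n.+1 := P @` realization R (cross_complex n).

Definition simplexwise (R : realType) (n : nat)
    (P : 'M[R]_(n, 2) -> 'rV[R]_n.+1) : Prop :=
  forall s : {set vertex n}, s \in cross_complex n -> s != finset.set0 ->
    ~ in_plane #|s|.-1 [set vertices P v | v in [set` s]] /\
    homeomorphism_onto (simplex R s) (spherical_hull s (vertices P)) P.

Definition nondegenerate_polyhedron (R : realType) (n : nat)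
    (P : 'M[R]_(n, 2) -> 'rV[R]_n.+1) : Prop :=
  [/\ body P `<=` @sphere R n,
      simplexwise P &
      forall L1 L2 : {set {set vertex n}},
        subcomplex L1 -> subcomplex L2 ->
        complex_dim L1 = n.-1 -> complex_dim L2 = n.-1 ->
        L1 :|: L2 = cross_complex n ->
        ~ in_plane n.-1 (P @` realization R (L1 :&: L2))].

Definition embedding (R : realType) (n : nat)
    (P : 'M[R]_(n, 2) -> 'rV[R]_n.+1) : Prop :=
  homeomorphism_onto (realization R (cross_complex n)) (body P) P.

(* Polyhedra with the same vertices are not distinguished, so being embedded
   must not depend on the homeomorphisms chosen on the simplices: if [P] is
   itself simplexwise, this is equivalent to [embedding P]. *)
Definition embedded (R : realType) (n : nat)
    (P : 'M[R]_(n, 2) -> 'rV[R]_n.+1) : Prop :=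
  exists Q, [/\ vertices Q = vertices P, simplexwise Q & embedding Q].

(* Congruence is by an orientation-preserving isometry of the sphere: a flexion
   through a polyhedron lying in a great sphere typically continues, on the
   other side, by the mirror images of the polyhedra already met. *)
Definition congruent (R : realType) (n : nat)
    (P Q : 'M[R]_(n, 2) -> 'rV[R]_n.+1) : Prop :=
  exists A : 'M[R]_n.+1,
    [/\ A *m A^T = 1%:M, \det A = 1 &
        forall v, vertices Q v = vertices P v *m A].

Definition flexible_cross_polytope (R : realType) (n : nat)
    (P : one_point_compactification R -> 'M[R]_(n, 2) -> 'rV[R]_n.+1) : Prop :=
  [/\ (forall u, body (P u) `<=` @sphere R n) /\
      {within [set: one_point_compactification R] `*`
                realization R (cross_complex n),
        continuous (fun ux => P ux.1 ux.2)},
      finite_set [set u | ~ nondegenerate_polyhedron (P u)],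
      forall v w : vertex n, v != w ->
        [set v; w]%SET \in cross_complex n ->
        forall u1 u2,
          spherical_distance (vertices (P u1) v) (vertices (P u1) w) =
          spherical_distance (vertices (P u2) v) (vertices (P u2) w) &
      forall u0 : one_point_compactification R, exists2 U, nbhs u0 U &
        forall u1 u2, U u1 -> U u2 -> u1 <> u2 -> ~ congruent (P u1) (P u2)].

(* Main.v *)
Require Import Defs.
From HB Require Import structures.
From mathcomp Require Import all_boot all_order all_algebra.
From mathcomp Require Import zify ring lra.
From mathcomp Require Import all_classical all_reals all_analysis.
Import Order.TTheory GRing.Theory Num.Theory.
Import numFieldNormedType.Exports.
Set Implicit Arguments.
Unset Strict Implicit.
Unset Printing Implicit Defensive.
Local Open Scope classical_set_scope.
Local Open Scope ring_scope.

(** Split R^(n+1) as a height axis e_0 and R^n with basis e_1, ..., e_n.  Fix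
    distinct positive numbers lam_i, put
    eps_ij = 2 lam_i lam_j / (lam_i^2 - lam_j^2) and consider the unit vectors
    [[
      a_i = e_i,    b_i = r_i (s_i e_0 - c_i e_i + sum_j eps_ij e_j),
    ]]
    where r_i > 0 normalizes b_i and (c_i, s_i) is the point of the unit circle
    whose half-angle has tangent lam_i u.  Thus the half-angle tangents of the
    exterior dihedral angles at the simplex a_1 ... a_n are proportional to u.
    As eps is antisymmetric, the scalar product of b_i and b_j is
    r_i r_j (eps_i . eps_j + s_i s_j - eps_ij (c_j - c_i)), and eps was chosen
    to make the last two terms cancel ([flex_relation]).  The other edges are
    visibly rigid, so all edge lengths are constant ([gram_flex_vertex]).

    The image of a point with weights alpha_i on a_i and beta_i / r_i on b_i
    has in R^n the coordinates alpha - c beta + beta eps.  Pairing it with beta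
    kills the eps term and leaves alpha . beta - sum_i c_i beta_i^2.  On the
    cross-polytope alpha_i beta_i = 0, and for a difference of two of its points
    alpha_i beta_i <= 0; hence the map is injective as soon as every c_i is
    positive, which for lam_i <= 1 holds when |u| < 1 ([tail_injective]).  Solving
    alpha - beta + beta eps = q with complementary nonnegative alpha and beta
    is a linear complementarity problem, and for small eps it is a fixed point
    of a contraction ([complementary_fixed_point]); this shows that the
    polyhedron at u = 0 covers the whole equator.  At u = infinity every c_i is
    -1 and every s_i is 0, and the b_i with the largest lam_i falls into the
    cone of a_1, ..., a_n, so that the polyhedron overlaps itself.

    The vertices of a simplex are independent at u = 0, and hence at every u,
    because their Gram matrix is constant ([independent_of_gram]).  A
    decomposition contradicting non-degeneracy cuts the facets into two classes;
    only facets adjacent across one fixed direction i can be separated, and then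
    all vertices other than a_i and b_i lie in one linear subspace of dimension
    n - 1, which eps_ji <> 0 excludes ([radial_map_nondegenerate]).

    For u > 0 the vector e_0 + tau (e_1 + ... + e_n), with tau a small positive
    multiple of s(u) = 2u / (1 + u^2), has positive scalar product with all
    vertices, and the situation is odd in u.  Up to scaling, and after a change
    of tau, this vector is the image of -e_0 under the reflection in a vector of
    the same form; so applying this reflection and then an isometry taking e_0
    to -m puts the family into the required hemispheres
    ([tilted_vertex_height]).  Finally a_i . b_i recovers c_i, and the
    determinant of b_i, a_1, ..., a_n recovers s_i; both are invariant under
    rotations, so no two members of the family are congruent
    ([tilted_not_congruent]). *)

(** * Continuity, closedness and compactness *)

(** A closed part of a compact set has a compact, hence closed, image; this is
    the continuity of the inverse. *)
Lemma homeomorphism_of_compact (S : ptopologicalType) (T : topologicalType)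
    (A : set S) (f : S -> T) :
  hausdorff_space T -> compact A -> {within A, continuous f} ->
  set_inj A f -> homeomorphism_onto A (f @` A) f.
Proof.
move=> T2 cA fA injf; split=> //; first by split => //; exact: image_subset.
exists (pinv A f); last first.
  by move=> x Ax; apply: pinvKV => //; apply/mem_set.
apply/continuous_closedP => C clC; apply/closed_subspaceP.
exists (f @` (A `&` C)).
  apply: compact_closed => //; apply: continuous_compact.
    by apply: continuous_subspaceW fA => x [].
  exact: compact_closedI.
have fK x : A x -> pinv A f (f x) = x.
  by move=> Ax; apply: pinvKV => //; apply/mem_set.
apply/seteqP; split=> y /=.
  move=> [[x [Ax Cx] <-] _]; split; last by exists x.
  by rewrite /from_subspace fK.
move=> [Cy [x Ax xy]]; split; last by exists x.
by exists x => //; split=> //; rewrite -(fK x Ax) xy.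
Qed.

Lemma continuous_mx (T : topologicalType) (K : topologicalType) (p q : nat)
    (f : T -> 'M[K]_(p, q)) (t : T) :
  (forall i j, {for t, continuous (fun x => f x i j)}) ->
  {for t, continuous f}.
Proof.
move=> fc U [P nP PU]; apply: filterS (PU) _.
have : \forall x \near t, forall i j, P i j (f x i j).
  apply: filter_forall => i; apply: filter_forall => j.
  exact: fc (nP i j).
by apply: filterS.
Qed.

(** Vectorization reduces the claim to boxes of row vectors. *)
Lemma compact_unit_box (R : realType) (p q : nat) (A : set 'M[R]_(p, q)) :
  closed A -> (forall x, A x -> forall i j, 0 <= x i j <= 1) -> compact A.
Proof.
move=> clA A01.
have vecC : continuous (vec_mx : 'rV[R]_(p * q) -> 'M[R]_(p, q)).
  move=> x; apply: continuous_mx => i j.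
  rewrite (_ : (fun y => _) = fun y : 'rV_(p * q) => y 0 (mxvec_index i j)).
    exact: coord_continuous.
  by apply/funext => y; rewrite mxE.
pose box := [set v : 'rV[R]_(p * q) | forall i, `[0, 1]%classic (v ord0 i)].
have cbox : compact (box `&` vec_mx @^-1` A).
  apply: compact_closedI; last exact: (continuous_closedP _).1 vecC _ clA.
  by apply: (@rV_compact R _ (fun=> `[0, 1]%classic)) => i; exact: segment_compact.
rewrite (_ : A = vec_mx @` (box `&` vec_mx @^-1` A)).
  by apply: continuous_compact cbox; exact: continuous_subspaceT.
apply/seteqP; split=> [x Ax|_ [y [_ Ay] <-] //].
exists (mxvec x); last by rewrite mxvecK.
split; last by rewrite /preimage /= mxvecK.
move=> k; case/mxvec_indexP: k => i j; rewrite mxvecE /= in_itv /=.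
exact: A01.
Qed.

Lemma closed_eq_fun (T : topologicalType) (R : realType) (f : T -> R) (c : R) :
  continuous f -> closed [set x | f x = c].
Proof.
by move=> fc; exact: ((continuous_closedP f).1 fc _ (@closed_eq R c)).
Qed.

Lemma closed_ge_fun (T : topologicalType) (R : realType) (f : T -> R) (c : R) :
  continuous f -> closed [set x | c <= f x].
Proof.
by move=> fc; exact: ((continuous_closedP f).1 fc _ (@closed_ge R c)).
Qed.

Lemma continuous_sumr (T : topologicalType) (R : realType) (I : finType)
    (F : I -> T -> R) (t : T) :
  (forall i, {for t, continuous (F i)}) ->
  {for t, continuous (fun x => \sum_i F i x)}.
Proof.
move=> Fc; apply: cvg_big; last by move=> i _; exact: Fc.
exact: add_continuous.
Qed.

(** * The inner product *)

Section InnerProduct.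
Variables (R : realType) (d : nat).
Implicit Types (x y z : 'rV[R]_d) (a : R).

Lemma dotpE x y : dotp x y = \sum_i x 0 i * y 0 i.
Proof. by rewrite /dotp mxE; apply: eq_bigr => i _; rewrite mxE. Qed.

Lemma dotpC x y : dotp x y = dotp y x.
Proof. by rewrite !dotpE; apply: eq_bigr => i _; rewrite mulrC. Qed.

Lemma dotpDl x y z : dotp (x + y) z = dotp x z + dotp y z.
Proof. by rewrite /dotp mulmxDl mxE. Qed.

Lemma dotpZl a x y : dotp (a *: x) y = a * dotp x y.
Proof. by rewrite /dotp -scalemxAl mxE. Qed.

Lemma dotpDr x y z : dotp x (y + z) = dotp x y + dotp x z.
Proof. by rewrite dotpC dotpDl !(dotpC x). Qed.

Lemma dotpZr a x y : dotp x (a *: y) = a * dotp x y.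
Proof. by rewrite dotpC dotpZl dotpC. Qed.

Lemma dotpNl x y : dotp (- x) y = - dotp x y.
Proof. by rewrite -scaleN1r dotpZl mulN1r. Qed.

Lemma dotpNr x y : dotp x (- y) = - dotp x y.
Proof. by rewrite dotpC dotpNl dotpC. Qed.

Lemma dotp_suml (I : finType) (F : I -> 'rV[R]_d) y :
  dotp (\sum_i F i) y = \sum_i dotp (F i) y.
Proof. by rewrite /dotp mulmx_suml summxE. Qed.

Lemma dotp_ge0 x : 0 <= dotp x x.
Proof. by rewrite dotpE sumr_ge0 // => i _; rewrite -expr2 sqr_ge0. Qed.

Lemma dotp_eq0 x : (dotp x x == 0) = (x == 0).
Proof.
apply/eqP/eqP => [|->]; last by rewrite /dotp mul0mx mxE.
rewrite dotpE => /psumr_eq0P x0; apply/rowP => i; rewrite mxE.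
by apply/eqP; rewrite -sqrf_eq0 expr2 x0 // => j _; rewrite -expr2 sqr_ge0.
Qed.

Lemma dotp_gt0 x : (0 < dotp x x) = (x != 0).
Proof. by rewrite lt0r dotp_ge0 andbT dotp_eq0. Qed.

Lemma dotp_mulmx (O : 'M[R]_d) x y : dotp (x *m O) y = dotp x (y *m O^T).
Proof. by rewrite /dotp trmx_mul trmxK mulmxA. Qed.

Lemma dotp_orthogonal (O : 'M[R]_d) x y :
  O *m O^T = 1%:M -> dotp (x *m O) (y *m O) = dotp x y.
Proof. by move=> OO; rewrite dotp_mulmx -mulmxA OO mulmx1. Qed.

Definition normalize x := (Num.sqrt (dotp x x))^-1 *: x.

Lemma sqrt_dotp_gt0 x : x != 0 -> 0 < Num.sqrt (dotp x x).
Proof. by rewrite sqrtr_gt0 dotp_gt0. Qed.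

Lemma dotp_normalize x : x != 0 -> dotp (normalize x) (normalize x) = 1.
Proof.
move=> x0; rewrite /normalize dotpZl dotpZr mulrA -expr2 exprVn.
by rewrite sqr_sqrtr ?dotp_ge0 // mulVf // dotp_eq0.
Qed.

Lemma normalize_id x : dotp x x = 1 -> normalize x = x.
Proof. by move=> x1; rewrite /normalize x1 sqrtr1 invr1 scale1r. Qed.

Lemma normalizeZ a x : 0 < a -> normalize (a *: x) = normalize x.
Proof.
move=> a0; rewrite /normalize dotpZl dotpZr mulrA -expr2.
rewrite sqrtrM ?sqr_ge0 // sqrtr_sqr gtr0_norm // scalerA invfM mulrAC.
by rewrite mulVf ?mul1r // gt_eqF.
Qed.

End InnerProduct.

(** * The geometric realization and radial maps *)

Section RadialMap.
Variables (R : realType) (n : nat).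
Implicit Types (p : vertex n -> 'rV[R]_n.+1) (x y : 'M[R]_(n, 2)).
Implicit Types (s : {set vertex n}).

(** The point with barycentric coordinates [x], sent linearly into the cone over
    the simplex spanned by the [p v]; [radial_map] projects it to the sphere. *)
Definition cone_map p x := \sum_(v : vertex n) x v.1 v.2 *: p v.

Definition radial_map p x := normalize (cone_map p x).

(** The matrices supported on a simplex of the cross-polytope, without reference
    to that simplex. *)
Definition complementary x := forall i, x i 0 * x i 1 = 0.

(** Linear independence of the images of the vertices of every simplex at once. *)
Definition independent p :=
  forall x, complementary x -> cone_map p x = 0 -> x = 0.

Lemma cone_mapD p x y : cone_map p (x + y) = cone_map p x + cone_map p y.
Proof.
by rewrite /cone_map -big_split; apply: eq_bigr => v _; rewrite mxE scalerDl.
Qed.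

Lemma cone_mapZ p a x : cone_map p (a *: x) = a *: cone_map p x.
Proof.
by rewrite /cone_map scaler_sumr; apply: eq_bigr => v _; rewrite mxE scalerA.
Qed.

Lemma cone_mapB p x y : cone_map p (x - y) = cone_map p x - cone_map p y.
Proof. by rewrite -scaleN1r cone_mapD cone_mapZ scaleN1r. Qed.

Lemma ord2E (i : 'I_2) : i = 0 \/ i = 1.
Proof. by case: i => [[|[|//]] ?]; [left|right]; apply/val_inj. Qed.

Lemma big_vertex (V : nmodType) (F : vertex n -> V) :
  \sum_v F v = \sum_i (F (i, 0) + F (i, 1)).
Proof.
rewrite (eq_bigr (fun v => F (v.1, v.2))) => [|[] //].
rewrite -(pair_bigA _ (fun i j => F (i, j))) /=; apply: eq_bigr => i _.
rewrite big_ord_recl big_ord1; congr (F (i, _) + F (i, _)); exact/val_inj.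
Qed.

Lemma mem_complex s :
  reflect (forall i, ~ ((i, 0) \in s /\ (i, 1) \in s)) (s \in cross_complex n).
Proof.
rewrite inE; apply: (iffP forallP) => H i; first by move/andP: (H i).
by apply/andP; exact: H.
Qed.

Definition supported s x := forall v : vertex n, v \notin s -> x v.1 v.2 = 0.

Lemma supported_complementary s x :
  s \in cross_complex n -> supported s x -> complementary x.
Proof.
move=> /mem_complex sK sx i; have := sK i.
have [i0|/sx /= ->] := boolP ((i, 0) \in s); last by rewrite mul0r.
have [i1|/sx /= ->] := boolP ((i, 1) \in s); last by rewrite mulr0.
by move/(_ (conj isT isT)).
Qed.

Lemma supportedB s x y : supported s x -> supported s y -> supported s (x - y).
Proof. by move=> sx sy v vs; rewrite !mxE sx // sy // subrr. Qed.

Lemma supportedZ s a x : supported s x -> supported s (a *: x).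
Proof. by move=> sx v vs; rewrite mxE sx // mulr0. Qed.

Lemma cone_map_supported s p x :
  supported s x -> cone_map p x = \sum_(v in s) x v.1 v.2 *: p v.
Proof.
move=> sx; rewrite /cone_map [RHS]big_mkcond; apply: eq_bigr => v _.
by case: ifPn => // /sx ->; rewrite scale0r.
Qed.

Definition support x : {set vertex n} := [set v | x v.1 v.2 != 0]%SET.

Lemma supported_support x : supported (support x) x.
Proof. by move=> v; rewrite inE negbK => /eqP. Qed.

Lemma support_complex x : complementary x -> support x \in cross_complex n.
Proof.
move=> cx; apply/mem_complex => i; rewrite !inE /= => -[x0 x1].
by have /eqP := cx i; rewrite mulf_eq0 (negPf x0) (negPf x1).
Qed.

Definition mass x := \sum_(v : vertex n) x v.1 v.2.

Lemma massZ a x : mass (a *: x) = a * mass x.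
Proof. by rewrite /mass mulr_sumr; apply: eq_bigr => v _; rewrite mxE. Qed.

Lemma mass_gt0 x : (forall i j, 0 <= x i j) -> x != 0 -> 0 < mass x.
Proof.
move=> x0 xn0; rewrite lt0r sumr_ge0 // andbT.
apply: contra xn0 => /eqP /psumr_eq0P m0; apply/eqP/matrixP => i j.
by rewrite mxE (m0 _ (i, j)).
Qed.

Lemma entry_le_mass x i j : (forall i j, 0 <= x i j) -> x i j <= mass x.
Proof. by move=> x0; rewrite /mass (bigD1 (i, j)) //= lerDl sumr_ge0. Qed.

(** The realization of the cross-polytope is cut out by finitely many closed
    conditions on the coordinates; membership in some simplex disappears. *)
Lemma realizationP x :
  realization R (cross_complex n) x <->
  [/\ forall i j, 0 <= x i j, complementary x & mass x = 1].
Proof.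
split=> [[s sK [x0 sx x1]]|[x0 cx x1]].
  split=> //; last exact: supported_complementary sx.
  by move=> i j; exact: (x0 (i, j)).
exists (support x); first exact: support_complex.
by split=> //; exact: supported_support.
Qed.

Lemma simplex_realization s x :
  s \in cross_complex n -> simplex R s x -> realization R (cross_complex n) x.
Proof. by move=> sK sx; exists s. Qed.

Lemma realization_neq0 x : realization R (cross_complex n) x -> x != 0.
Proof.
move=> /realizationP[_ _ m1]; apply: contra_eq_neq m1 => ->.
rewrite /mass big1 ?(eq_sym _ 1) ?oner_eq0 // => v _; exact: mxE.
Qed.

Lemma cone_map_neq0 p x :
  independent p -> realization R (cross_complex n) x -> cone_map p x != 0.
Proof.
move=> ip xK; have := realization_neq0 xK; apply: contra_neq => x0.
by apply: ip => //; have /realizationP[] := xK.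
Qed.

Lemma continuous_entry (i : 'I_n) (j : 'I_2) :
  continuous (fun x : 'M[R]_(n, 2) => x i j).
Proof. exact: coord_continuous. Qed.

Lemma continuous_mass : continuous mass.
Proof. by move=> x; apply: continuous_sumr => v; exact: continuous_entry. Qed.

Lemma compact_simplex s : compact (simplex R s).
Proof.
have simplexE : simplex R s =
    (\bigcap_(v in [set: vertex n]) [set x : 'M[R]_(n, 2) | 0 <= x v.1 v.2]) `&`
    (\bigcap_(v in [set v | v \notin s]) [set x : 'M[R]_(n, 2) | x v.1 v.2 = 0]) `&`
    [set x | mass x = 1].
  apply/seteqP; split=> x /= => [[x0 sx x1]|[[x0 sx] x1]].
    by split=> //; split=> [v _|v vs] /=; [exact: x0|exact: sx].
  by split=> [v|v vs|//]; [exact: (x0 v I)|exact: sx].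
apply: compact_unit_box.
  rewrite simplexE; apply: closedI; last exact/closed_eq_fun/continuous_mass.
  apply: closedI; apply: closed_bigI => v _.
    exact/closed_ge_fun/continuous_entry.
  exact/closed_eq_fun/continuous_entry.
move=> x [x0 _ x1] i j; rewrite (x0 (i, j)) -x1 entry_le_mass // => k l.
exact: (x0 (k, l)).
Qed.

Lemma compact_realization : compact (realization R (cross_complex n)).
Proof.
have realizationE : realization R (cross_complex n) =
    (\bigcap_(v in [set: vertex n]) [set x : 'M[R]_(n, 2) | 0 <= x v.1 v.2]) `&`
    (\bigcap_(i in [set: 'I_n]) [set x : 'M[R]_(n, 2) | x i 0 * x i 1 = 0]) `&`
    [set x | mass x = 1].
  apply/seteqP; split=> x /= => [/realizationP[x0 cx x1]|[[x0 cx] x1]].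
    by split=> //; split=> [v _|v _] /=; [exact: x0|exact: cx].
  by apply/realizationP; split=> [i j|i|//]; [exact: (x0 (i, j) I)|exact: (cx i I)].
apply: compact_unit_box; last first.
  by move=> x /realizationP[x0 _ x1] i j; rewrite x0 -x1 entry_le_mass.
rewrite realizationE; apply: closedI; last exact/closed_eq_fun/continuous_mass.
apply: closedI; apply: closed_bigI => v _.
  exact/closed_ge_fun/continuous_entry.
apply/closed_eq_fun => x.
by apply: (@continuousM _ _ (fun x : 'M[R]_(n, 2) => x v 0) (fun x => x v 1));
  exact: continuous_entry.
Qed.

End RadialMap.

(** * The polyhedron spanned by a family of vertices *)

(** Vertices and point vary together, which covers both a fixed polyhedron and
    the joint continuity of a flex. *)
Lemma continuous_radial_map (R : realType) (n : nat) (T : topologicalType)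
    (p : T -> vertex n -> 'rV[R]_n.+1) (x : T -> 'M[R]_(n, 2)) (t : T) :
  (forall v j, {for t, continuous (fun u => p u v 0 j)}) ->
  (forall i j, {for t, continuous (fun u => x u i j)}) ->
  cone_map (p t) (x t) != 0 ->
  {for t, continuous (fun u => radial_map (p u) (x u))}.
Proof.
move=> pc xc pt0; apply: continuous_mx => i j; rewrite (ord1 i) => {i}.
pose c u k := \sum_(v : vertex n) x u v.1 v.2 * p u v 0 k.
have cE u k : cone_map (p u) (x u) 0 k = c u k.
  by rewrite summxE; apply: eq_bigr => v _; rewrite mxE.
have cc k : {for t, continuous (fun u => c u k)}.
  apply: continuous_sumr => v; apply: continuousM; [exact: xc|exact: pc].
pose q u := \sum_k c u k * c u k.
have qE u : dotp (cone_map (p u) (x u)) (cone_map (p u) (x u)) = q u.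
  by rewrite dotpE; apply: eq_bigr => k _; rewrite cE.
rewrite (_ : (fun u => _) = fun u => (Num.sqrt (q u))^-1 * c u j); last first.
  by apply/funext => u; rewrite /radial_map /normalize mxE qE cE.
apply: continuousM; last exact: cc.
apply: (@continuousV _ _ (fun u => Num.sqrt (q u))).
  by rewrite -qE gt_eqF // sqrt_dotp_gt0.
apply: (@continuous_comp _ _ _ q Num.sqrt); last exact: sqrt_continuous.
by apply: continuous_sumr => k; apply: continuousM; exact: cc.
Qed.

Section RadialPolyhedron.
Variables (R : realType) (n : nat) (p : vertex n -> 'rV[R]_n.+1).
Implicit Types (x y : 'M[R]_(n, 2)) (s : {set vertex n}).

Lemma cone_map_vertex_point v : cone_map p (vertex_point R v) = p v.
Proof.
rewrite /cone_map (bigD1 v) //= mxE !eqxx scale1r big1 ?addr0 // => w wv.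
rewrite mxE -pair_eqE /= in wv *; by rewrite (negPf wv) scale0r.
Qed.

Lemma vertex_point_simplex s v : v \in s -> simplex R s (vertex_point R v).
Proof.
move=> vs; split=> [w|w ws|].
- by rewrite mxE; case: (_ && _).
- rewrite mxE; case: andP => // -[/eqP w1 /eqP w2].
  by rewrite [w]surjective_pairing w1 w2 -surjective_pairing vs in ws.
- rewrite (bigD1 v) //= mxE !eqxx big1 ?addr0 // => w wv.
  by rewrite mxE -pair_eqE /= in wv *; rewrite (negPf wv).
Qed.

Hypothesis p1 : forall v, dotp (p v) (p v) = 1.

Lemma vertices_radial_map : vertices (radial_map p) = p.
Proof.
by apply/funext => v; rewrite /vertices /radial_map cone_map_vertex_point normalize_id.
Qed.

Hypothesis ip : independent p.

Lemma radial_map_sphere : body (radial_map p) `<=` @sphere R n.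
Proof.
by move=> _ [x xK <-]; apply: dotp_normalize; exact: cone_map_neq0.
Qed.

(** Equality on the sphere is proportionality in the cones over it, and the
    factor can be moved to the barycentric coordinates. *)
Lemma radial_map_eq x y :
  realization R (cross_complex n) x -> realization R (cross_complex n) y ->
  radial_map p x = radial_map p y ->
  exists2 a, 0 < a & cone_map p x = cone_map p (a *: y).
Proof.
move=> xK yK; have /sqrt_dotp_gt0 x0 := cone_map_neq0 ip xK.
have /sqrt_dotp_gt0 y0 := cone_map_neq0 ip yK.
rewrite /radial_map /normalize => xy.
exists (Num.sqrt (dotp (cone_map p x) (cone_map p x)) *
        (Num.sqrt (dotp (cone_map p y) (cone_map p y)))^-1).
  by rewrite mulr_gt0 ?invr_gt0.
by rewrite cone_mapZ -scalerA -xy scalerA divff ?scale1r // gt_eqF.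
Qed.

Lemma mass_scale_inj x y a : mass x = 1 -> mass y = 1 -> x = a *: y -> x = y.
Proof.
move=> mx my xy; suff a1 : a = 1 by rewrite xy a1 scale1r.
by rewrite -mx xy massZ my mulr1.
Qed.

Lemma radial_map_inj_simplex s :
  s \in cross_complex n -> set_inj (simplex R s) (radial_map p).
Proof.
move=> sK x y; rewrite !inE => sx sy xy.
have [a a0 /eqP] := radial_map_eq (simplex_realization sK sx)
  (simplex_realization sK sy) xy.
rewrite -subr_eq0 -cone_mapB => /eqP xy0.
case: sx sy => _ sx mx [_ sy my].
apply: (mass_scale_inj mx my (a := a)); apply/eqP; rewrite -subr_eq0; apply/eqP.
apply: ip => //; apply: (supported_complementary sK).
by apply: supportedB => //; exact: supportedZ.
Qed.

(** A point of the hull lifts by dividing its cone coefficients by their sum;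
    normalization ignores that factor. *)
Lemma radial_map_simplex s :
  s \in cross_complex n -> radial_map p @` simplex R s = spherical_hull s p.
Proof.
move=> sK; apply/seteqP; split=> y.
  move=> [x sx <-]; have xK := simplex_realization sK sx.
  have x0 := cone_map_neq0 ip xK; split; first exact: dotp_normalize.
  case: sx => x_ge0 sx _.
  exists (fun v => (Num.sqrt (dotp (cone_map p x) (cone_map p x)))^-1 * x v.1 v.2).
    by move=> v; rewrite mulr_ge0 // invr_ge0 sqrtr_ge0.
  rewrite /radial_map /normalize; set a := (Num.sqrt _)^-1.
  rewrite (cone_map_supported _ sx) scaler_sumr.
  by apply: eq_bigr => v _; rewrite scalerA.
move=> [y1 [c c0 yE]].
pose x0 : 'M[R]_(n, 2) := \matrix_(i, j) if (i, j) \in s then c (i, j) else 0.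
have sx0 : supported s x0 by move=> [i j] /negPf ijs; rewrite mxE ijs.
have x0_ge0 i j : 0 <= x0 i j by rewrite mxE; case: ifP.
have yx0 : y = cone_map p x0.
  rewrite (cone_map_supported _ sx0) yE; apply: eq_bigr => -[i j] ijs.
  by rewrite mxE ijs.
have x0_neq0 : x0 != 0.
  apply: contra_eq_neq y1 => x00.
  by rewrite yx0 x00 -(scale0r x0) cone_mapZ scale0r /dotp mul0mx mxE eq_sym oner_eq0.
have m0 := mass_gt0 x0_ge0 x0_neq0.
exists ((mass x0)^-1 *: x0).
  split; [|exact: supportedZ|].
    by move=> v; rewrite mxE mulr_ge0 // invr_ge0 ltW.
  by rewrite -/(mass _) massZ mulVf // gt_eqF.
by rewrite /radial_map cone_mapZ normalizeZ ?invr_gt0 // -yx0 normalize_id.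
Qed.

Lemma radial_map_continuous :
  {within realization R (cross_complex n), continuous (radial_map p)}.
Proof.
apply: continuous_in_subspaceT => x; rewrite inE => xK.
apply: (@continuous_radial_map R n _ (fun=> p) id).
- by move=> v j; apply: cst_continuous.
- by move=> i j; exact: continuous_entry.
- exact: cone_map_neq0.
Qed.

(** Bridge from coefficient matrices to the free families of vector space
    theory, where dimensions are available. *)
Lemma independent_free s :
  s \in cross_complex n -> free (image_tuple p s).
Proof.
move=> sK; apply/freeP => k k0 l.
pose x : 'M[R]_(n, 2) := \matrix_(i, j)
  \sum_(l < #|s|) (if enum_val l == (i, j) then k l else 0).
have xvE (l0 : 'I_#|s|) : x (enum_val l0).1 (enum_val l0).2 = k l0.
  rewrite mxE (bigD1 l0) //= -surjective_pairing eqxx big1 ?addr0 // => l' l'l.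
  by rewrite (inj_eq enum_val_inj) (negPf l'l).
have sx : supported s x.
  move=> [i j] ijs; rewrite mxE big1 // => l' _; case: eqP => // ijE.
  by rewrite -ijE enum_valP in ijs.
rewrite -xvE (_ : x = 0) ?mxE //; apply: ip.
  exact: supported_complementary sx.
rewrite (cone_map_supported _ sx) big_enum_val -[RHS]k0.
by apply: eq_bigr => l' _; rewrite xvE nth_image.
Qed.

Section Span.
Variables (s : {set vertex n}) (U : {vspace 'rV[R]_n.+1}).
Hypotheses (sK : s \in cross_complex n) (pU : forall v, v \in s -> p v \in U).

Let span_sub : (<<image_tuple p s>> <= U)%VS.
Proof. by apply/span_subvP => w /fintype.imageP[v vs ->]; exact: pU. Qed.

Lemma card_le_dim : (#|s| <= \dim U)%N.
Proof.
have := dimvS span_sub; have /eqP -> := independent_free sK.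
by rewrite size_tuple.
Qed.

(** The images of the vertices of [s] are a basis of [U]. *)
Lemma mem_span_full w : #|s| = \dim U -> w \in U ->
  exists c : vertex n -> R, w = \sum_(v in s) c v *: p v.
Proof.
move=> sU; have /eqP <- : <<image_tuple p s>>%VS == U.
  rewrite eqEdim span_sub -sU; have /eqP -> := independent_free sK.
  by rewrite size_tuple /=.
move/coord_span => wE; pose k l := coord (image_tuple p s) l w.
exists (fun v => \sum_(l < #|s|) (if enum_val l == v then k l else 0)).
rewrite [RHS]big_enum_val {1}wE; apply: eq_bigr => l _.
rewrite nth_image; congr (_ *: _).
rewrite (bigD1 l) //= eqxx big1 ?addr0 // => l' l'l.
by rewrite (inj_eq enum_val_inj) (negPf l'l).
Qed.

End Span.

End RadialPolyhedron.

(** * Facets and non-degeneracy *)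

Section Facets.
Variable n : nat.
Implicit Types (S T : {set 'I_n}) (s t : {set vertex n}).

(** A facet picks one vertex from each pair {a_i, b_i}; [S] is the set of the
    indices where it picks b_i. *)
Definition side S i : 'I_2 := if i \in S then 1 else 0.

Definition facet S : {set vertex n} := [set (i, side S i) | i in [set: 'I_n]]%SET.

Definition ridge S k : {set vertex n} := [set (i, side S i) | i in [set~ k]]%SET.

Lemma mem_facet S i j : ((i, j) \in facet S) = (j == side S i).
Proof.
apply/imsetP/eqP => [[k _ [-> ->]] //|->].
by exists i; rewrite ?inE.
Qed.

Lemma mem_ridge S k i j : ((i, j) \in ridge S k) = (i != k) && (j == side S i).
Proof.
apply/imsetP/andP => [[l]|[ik /eqP->]].
  by rewrite !inE => lk [-> ->]; rewrite eqxx.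
by exists i; rewrite ?inE.
Qed.

Lemma side_inj S : injective (fun i => (i, side S i)).
Proof. by move=> i j []. Qed.

Lemma card_facet S : #|facet S| = n.
Proof. by rewrite card_imset ?cardsT ?card_ord //; exact: side_inj. Qed.

Lemma card_ridge S k : #|ridge S k| = n.-1.
Proof. by rewrite card_imset ?cardsC1 ?card_ord //; exact: side_inj. Qed.

Lemma facet_complex S : facet S \in cross_complex n.
Proof.
apply/mem_complex => i; rewrite !mem_facet => -[/eqP <-].
by move/eqP.
Qed.

Lemma subset_complex s t :
  s \subset t -> t \in cross_complex n -> s \in cross_complex n.
Proof.
move=> /fintype.subsetP st /mem_complex tK; apply/mem_complex => i [s0 s1].
by apply: (tK i); split; exact: st.
Qed.

Lemma ridge_sub_facet S k : ridge S k \subset facet S.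
Proof. by apply/fintype.subsetP => -[i j]; rewrite mem_ridge mem_facet => /andP[]. Qed.

Lemma ridge_sub_facetU S k : ridge S k \subset facet (k |: S).
Proof.
apply/fintype.subsetP => -[i j]; rewrite mem_ridge mem_facet /side !inE.
by move=> /andP[/negPf ->].
Qed.

Lemma facet_of_card s :
  s \in cross_complex n -> (n <= #|s|)%N -> s = facet [set i | (i, 1) \in s]%SET.
Proof.
move=> /mem_complex sK ns; apply/eqP; rewrite eqEcard card_facet ns andbT.
apply/fintype.subsetP => -[i j] ijs; rewrite mem_facet /side inE.
case: (ord2E j) ijs => -> ijs; last by rewrite ijs.
by case: ifP => // i1; case: (sK i).
Qed.

(** The dimension is a truncated predecessor, so the bound on [n] is what tells
    dimension n - 1 from the dimension of the empty complex. *)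
Lemma facet_of_complex_dim (L : {set {set vertex n}}) : (2 <= n)%N ->
  subcomplex L -> complex_dim L = n.-1 -> exists S, facet S \in L.
Proof.
move=> n2 [LK _]; rewrite /complex_dim => Ln.
have L0 : (0 < #|L|)%N.
  rewrite lt0n; apply: contra_eqN Ln => /eqP/cards0_eq ->.
  by rewrite big_pred0 => [|i]; [case: n n2 => [|[]]|rewrite inE].
have [s sL sE] := eq_bigmax_cond (fun s : {set vertex n} => #|s|) L0.
rewrite sE in Ln; have sn : (n <= #|s|)%N.
  by move: #|s| Ln n2 => c; lia.
exists [set i | (i, 1) \in s]%SET; rewrite -facet_of_card //.
exact: (fintype.subsetP LK).
Qed.

(** Facets are joined by flipping one vertex at a time; this is how a colouring
    of the facets is propagated along such flips. *)
Lemma setU_invariant (V : Type) (f : {set 'I_n} -> V) (A : {set 'I_n}) :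
  (forall i S, i \in A -> f (i |: S) = f S) -> forall S, f (A :|: S) = f S.
Proof.
have [m] := ubnP #|A|; elim: m A => // m IH A Am fA S.
have [->|[i iA]] := set_0Vmem A; first by rewrite finset.set0U.
rewrite -(finset.setD1K iA) -finset.setUA fA //; apply: IH => [|j T].
  by move: Am; rewrite (cardsD1 i) iA.
by rewrite in_setD1 => /andP[_ /fA].
Qed.

End Facets.

Section NondegeneratePolyhedra.
Variables (R : realType) (n : nat) (p : vertex n -> 'rV[R]_n.+1).
Hypotheses (p1 : forall v, dotp (p v) (p v) = 1) (ip : independent p).

Lemma radial_map_simplexwise : simplexwise (radial_map p).
Proof.
move=> s sK s0; rewrite (vertices_radial_map p1); split; last first.
  rewrite -(radial_map_simplex ip sK); apply: homeomorphism_of_compact.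
  - exact: norm_hausdorff.
  - exact: compact_simplex.
  - apply: continuous_subspaceW (radial_map_continuous ip).
    by move=> x; exact: simplex_realization.
  - exact: radial_map_inj_simplex.
move=> [U [dimU sU]]; have /(card_le_dim ip sK) : forall v, v \in s -> p v \in U.
  by move=> v vs; case: (sU (p v)) => //; exists v.
by rewrite dimU -ltnS prednK ?ltnn // card_gt0.
Qed.

(** Two points with the same image on the sphere become, after rescaling one of
    them, points with the same image in the cones, so injectivity there is enough. *)
Lemma radial_map_embedding :
  (forall x y, complementary x -> complementary y ->
    (forall i j, 0 <= x i j) -> (forall i j, 0 <= y i j) ->
    cone_map p x = cone_map p y -> x = y) ->
  embedding (radial_map p).
Proof.
move=> pinj; apply: homeomorphism_of_compact.
- exact: norm_hausdorff.
- exact: compact_realization.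
- exact: radial_map_continuous.
move=> x y; rewrite !inE => xK yK xy; have [a a0 axy] := radial_map_eq ip xK yK xy.
case/realizationP: xK yK => x0 cx mx /realizationP[y0 cy my].
apply: (mass_scale_inj mx my (a := a)); apply: pinj => // [i|i j].
  by rewrite !mxE mulrACA cy mulr0.
by rewrite mxE mulr_ge0 // ltW.
Qed.

(** Colour the facets by membership in the first subcomplex.  A ridge between
    facets of different colours is mapped into the subspace [U] and spans it,
    so its two apices are mapped outside [U].  Therefore ridges that contain one
    of these apices never separate colours: only the direction [k] of the first
    ridge does, and there all ridges do.  In particular [U] contains the images
    of all vertices other than a_k and b_k, among them b_j. *)
Lemma radial_map_nondegenerate : (2 <= n)%N ->
  (forall i, exists2 j, j != i & forall c : vertex n -> R,
    p (j, 1) <> \sum_(v in ridge finset.set0 i) c v *: p v) ->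
  nondegenerate_polyhedron (radial_map p).
Proof.
move=> n2 p_span; split; first exact: radial_map_sphere.
  exact: radial_map_simplexwise.
move=> L1 L2 subL1 subL2 dim1 dim2 L12 [U [dimU LU]].
have pU s v : s \in L1 -> s \in L2 -> v \in s -> p v \in U.
  move=> s1 s2 vs; case: (LU (p v)) => //.
  exists (vertex_point R v); last by rewrite -{2}(vertices_radial_map p1).
  exists s; first by rewrite finset.in_setI s1.
  exact: vertex_point_simplex.
have no_facet S : ~ (forall v, v \in facet S -> p v \in U).
  by move=> /(card_le_dim ip (facet_complex S)); rewrite card_facet dimU; lia.
pose col S := facet S \in L1.
have facet2 S : ~~ col S -> facet S \in L2.
  by have := facet_complex S; rewrite -L12 finset.in_setU => /orP[fS|//] /negP[].
have facet12 S : facet S \in L1 -> facet S \in L2 -> False.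
  by move=> f1 f2; apply: (no_facet S) => v; exact: pU.
(* A ridge lies in both of its facets, hence in both subcomplexes when these
   facets have different colours. *)
have ridgeU S k v : col (k |: S)%SET != col S -> v \in ridge S k -> p v \in U.
  have [_ down1] := subL1; have [_ down2] := subL2.
  move=> colS; apply: pU.
    have [cS|cS] := boolP (col S); first exact: down1 cS (ridge_sub_facet S k).
    apply: down1 (ridge_sub_facetU S k).
    by rewrite (negPf cS) eqbF_neg negbK in colS.
  have [cS|cS] := boolP (col S); last first.
    exact: down2 (facet2 _ cS) (ridge_sub_facet S k).
  apply: down2 (facet2 _ _) (ridge_sub_facetU S k).
  by rewrite cS eqb_id in colS.
have flipN S k : col (k |: S)%SET != col S -> k \notin S.
  by apply: contra => kS; rewrite (finset.setUidPr _) // finset.sub1set.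
(* Together with an apex the ridge is a facet, too large to fit into [U]. *)
have apexU S k j : col (k |: S)%SET != col S -> ~ p (k, j) \in U.
  move=> colS kU.
  have [kj|kj] : j = side S k \/ j = side (k |: S)%SET k.
  - have kS := flipN _ _ colS; rewrite /side (negPf kS) !inE eqxx.
    exact: ord2E.
  - apply: (no_facet S) => -[i l]; rewrite mem_facet => /eqP->.
    have [->|ik] := eqVneq i k; first by rewrite -kj.
    by apply: (ridgeU S k) => //; rewrite mem_ridge ik eqxx.
  - apply: (no_facet (k |: S)%SET) => -[i l]; rewrite mem_facet => /eqP->.
    have [->|ik] := eqVneq i k; first by rewrite -kj.
    apply: (ridgeU S k) => //; rewrite mem_ridge ik /=.
    by rewrite /side !inE (negPf ik).
have [S1 f1] := facet_of_complex_dim n2 subL1 dim1.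
have [S2 f2] := facet_of_complex_dim n2 subL2 dim2.
(* Some flip changes the colour: otherwise all facets are in the first
   subcomplex, including one that is in the second. *)
have [k [S colk]] : exists k S, col (k |: S)%SET != col S.
  apply: contrapT => /forallNP noflip.
  have colC i S : col (i |: S)%SET = col S.
    by apply/eqP; apply: contrapT => /negP colS; apply: (noflip i); exists S.
  have colE S : col S = col finset.set0.
    by rewrite -(finset.setU0 S) (@setU_invariant _ _ col).
  by apply: (facet12 S2) => //; rewrite -/(col S2) colE -(colE S1).
have kS := flipN _ _ colk.
have other i T : i != k -> col (i |: T)%SET = col T.
  move=> ik; apply/eqP; apply: contrapT => /negP colT.
  apply: (apexU S k (side T k)) => //; apply: (ridgeU T i) => //.
  by rewrite mem_ridge eq_sym ik eqxx.
(* Hence the colour depends only on whether the facet contains a_k or b_k, and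
   the flip in direction [k] can be moved to any other facet. *)
have colSU T : col (S :|: T)%SET = col T.
  apply: setU_invariant => i T'; have [->|ik _] := eqVneq i k; last exact: other.
  by rewrite (negPf kS).
have colk0 : col (k |: finset.set0)%SET != col finset.set0.
  by rewrite -(colSU finset.set0) -(colSU (_ |: _))%SET finset.setUCA finset.setU0.
have [j jk pj] := p_span k.
have colkj : col (k |: (j |: finset.set0))%SET != col (j |: finset.set0)%SET.
  by rewrite finset.setUCA !(other j).
have aU v : v \in ridge finset.set0 k -> p v \in U by exact: ridgeU.
have bU : p (j, 1) \in U.
  apply: (ridgeU _ _ _ colkj); rewrite mem_ridge jk /= /side !inE eqxx.
  by [].
have rK : ridge finset.set0 k \in cross_complex n.
  exact: subset_complex (ridge_sub_facet _ _) (facet_complex _).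
have [|c] := mem_span_full ip rK aU _ bU; last exact: pj.
by rewrite card_ridge.
Qed.

(** An embedding would preserve disjointness of the vertex b_i from the facet of
    the a_k, while its image lies in the hull of that facet. *)
Lemma radial_map_not_embedded i (c : vertex n -> R) : (forall v, 0 <= c v) ->
  p (i, 1) = \sum_(v in facet finset.set0) c v *: p v ->
  ~ embedded (radial_map p).
Proof.
move=> c0 pE [Q [Qp simpQ embQ]].
rewrite (vertices_radial_map p1) in Qp.
have [|_ [[_ _ surjQ] _ _]] := simpQ _ (facet_complex finset.set0).
  by rewrite -card_gt0 card_facet; have := ltn_ord i; lia.
have [|x xs Qx] := surjQ (p (i, 1)).
  by split; [exact: p1|exists c => //; rewrite Qp].
have [[_ injQ _] _ _] := embQ.
have x1 : x = vertex_point R (i, 1).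
  apply: injQ.
  - by rewrite inE; apply: simplex_realization xs; exact: facet_complex.
  - rewrite inE; exists [set (i, 1)]%SET.
      apply/mem_complex => k; rewrite !inE => -[/eqP[]].
      by [].
    by apply: vertex_point_simplex; rewrite inE.
  - by rewrite Qx -Qp.
have [_ /(_ (i, 1)) + _] := xs.
rewrite x1 mem_facet /side finset.in_set0 mxE !eqxx => /(_ isT) /eqP.
by rewrite oner_eq0.
Qed.
End NondegeneratePolyhedra.

(** * Reflections and coordinates with a height *)

Section Reflection.
Variables (R : realType) (d : nat).
Implicit Types (w x y : 'rV[R]_d).

Definition reflection w : 'M[R]_d := 1%:M - (2 / dotp w w) *: (w^T *m w).

Lemma mulmx_reflection x w :
  x *m reflection w = x - (2 * dotp x w / dotp w w) *: w.
Proof.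
rewrite /reflection mulmxBr mulmx1 -scalemxAr mulmxA.
rewrite [x *m w^T]mx11_scalar mul_scalar_mx scalerA -/(dotp x w).
by rewrite mulrAC -mulrA mulrCA mulrA.
Qed.

Lemma tr_reflection w : (reflection w)^T = reflection w.
Proof. by rewrite /reflection linearB linearZ /= tr_scalar_mx trmx_mul trmxK. Qed.

Lemma reflection_orthogonal w :
  w != 0 -> reflection w *m (reflection w)^T = 1%:M.
Proof.
rewrite -dotp_eq0 => w0; rewrite tr_reflection; apply/row_matrixP => i.
rewrite !rowE mulmxA mulmx1 !mulmx_reflection -[RHS]addr0 -addrA.
congr (_ + _); rewrite -opprD -scalerDl dotpDl dotpNl dotpZl.
rewrite (_ : _ + _ = 0) ?scale0r ?oppr0 //.
by field.
Qed.

(** Factor the block matrix with rows (1, v) and (u^T, 1) in two ways. *)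
Lemma det_1sub_mul (p : nat) (u v : 'rV[R]_p) :
  \det (1%:M - u^T *m v) = 1 - dotp v u.
Proof.
have M1 : block_mx (1%:M : 'M[R]_1) v (u^T) 1%:M =
    block_mx 1%:M 0 (u^T) 1%:M *m block_mx 1%:M v 0 (1%:M - u^T *m v).
  by rewrite mulmx_block !mul1mx !mulmx1 !mul0mx !addr0 addrC subrK.
have M2 : block_mx (1%:M : 'M[R]_1) v (u^T) 1%:M =
    block_mx (1%:M - v *m u^T) v 0 1%:M *m block_mx 1%:M 0 (u^T) 1%:M.
  by rewrite mulmx_block !mul1mx !mulmx1 !mul0mx !mulmx0 !add0r subrK.
move: (congr1 determinant M1); rewrite M2 !det_mulmx.
rewrite !det_ublock !det_lblock !det1 !mul1r !mulr1 => <-.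
by rewrite det_mx11 /dotp !mxE.
Qed.

Lemma det_reflection w : w != 0 -> \det (reflection w) = -1.
Proof.
rewrite -dotp_eq0 => w0; rewrite /reflection scalemxAr det_1sub_mul dotpZl.
by rewrite divfK //; lra.
Qed.

(** Reflect in the hyperplane bisecting [x] and [y]. *)
Lemma exists_orthogonal x y : dotp x x = 1 -> dotp y y = 1 ->
  exists2 O : 'M[R]_d, O *m O^T = 1%:M & x *m O = y.
Proof.
move=> x1 y1; have [->|xy] := eqVneq x y.
  by exists 1%:M; rewrite ?trmx1 ?mulmx1.
exists (reflection (x - y)); first by apply: reflection_orthogonal; rewrite subr_eq0.
have xy0 : dotp (x - y) (x - y) != 0 by rewrite dotp_eq0 subr_eq0.
rewrite mulmx_reflection (_ : 2 * _ / _ = 1) ?scale1r ?subKr //.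
apply: (canLR (mulfK _)) => //.
rewrite mul1r !(dotpDl, dotpDr, dotpNl, dotpNr) x1 y1 (dotpC y x); ring.
Qed.

End Reflection.

Section Height.
Variables (R : realType) (n : nat).
Implicit Types (h : R) (w : 'rV[R]_n).

(** The first coordinate is the height; the others are those of [w]. *)
Definition lift_height h w : 'rV[R]_n.+1 := row_mx (h%:M : 'M[R]_1) w.

Lemma dotp_lift_height h w h' w' :
  dotp (lift_height h w) (lift_height h' w') = h * h' + dotp w w'.
Proof.
have -> : dotp (lift_height h w) (lift_height h' w') =
    (row_mx (h%:M : 'M[R]_1) w *m (row_mx (h'%:M : 'M[R]_1) w')^T) 0 0 by [].
by rewrite tr_row_mx mul_row_col mxE tr_scalar_mx -scalar_mxM mxE eqxx.
Qed.

Definition head_index : 'I_n.+1 := lshift n (0 : 'I_1).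

Definition tail_index (k : 'I_n) : 'I_n.+1 := rshift 1 k.

Lemma lift_head h w : lift_height h w 0 head_index = h.
Proof. by apply: etrans (row_mxEl _ _ _ _) _; rewrite mxE. Qed.

Lemma lift_tail h w k : lift_height h w 0 (tail_index k) = w 0 k.
Proof. exact: row_mxEr. Qed.

End Height.

(** * The flexing family of unit vectors *)

Section ChangeOfVertices.
Variables (R : realType) (n : nat).
Implicit Types (p q : vertex n -> 'rV[R]_n.+1) (x : 'M[R]_(n, 2)).

Lemma cone_map_mulmx p (O : 'M[R]_n.+1) x :
  cone_map (fun v => p v *m O) x = cone_map p x *m O.
Proof.
by rewrite /cone_map mulmx_suml; apply: eq_bigr => v _; rewrite scalemxAl.
Qed.

Lemma dotp_cone_map p x y : dotp (cone_map p x) y = \sum_v x v.1 v.2 * dotp (p v) y.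
Proof. by rewrite dotp_suml; apply: eq_bigr => v _; rewrite dotpZl. Qed.

Lemma cone_mapE p x k : cone_map p x 0 k = \sum_v x v.1 v.2 * p v 0 k.
Proof. by rewrite summxE; apply: eq_bigr => v _; rewrite mxE. Qed.

(** For coefficients supported on a simplex the squared norm of the combination
    only involves scalar products of equal or adjacent vertices. *)
Lemma independent_of_gram p q :
  (forall v w, v = w \/ v.1 != w.1 -> dotp (p v) (p w) = dotp (q v) (q w)) ->
  independent p -> independent q.
Proof.
move=> pq ip x cx qx0; apply: ip => //; apply/eqP; rewrite -dotp_eq0.
suff -> : dotp (cone_map p x) (cone_map p x) = dotp (cone_map q x) (cone_map q x).
  by rewrite qx0 dotp_eq0.
rewrite !dotp_cone_map; apply: eq_bigr => v _.
have [->|xv0] := eqVneq (x v.1 v.2) 0; first by rewrite !mul0r.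
rewrite (dotpC (p v)) (dotpC (q v)) !dotp_cone_map; congr (_ * _); apply: eq_bigr => w _.
have [->|xw0] := eqVneq (x w.1 w.2) 0; first by rewrite !mul0r.
congr (_ * _); apply: pq; have [vw|] := eqVneq w.1 v.1; last by right.
left; case: v w xv0 xw0 vw => [i j] [k l] /= xv0 xw0 ki.
rewrite {}ki in xw0 *; have := cx i.
by case: (ord2E j) (ord2E l) xv0 xw0 => -> [] -> // /eqP x0 /eqP x1 /eqP;
  rewrite mulf_eq0 => /orP[] /eqP.
Qed.

End ChangeOfVertices.

Section Family.
Variables (R : realType) (n : nat) (lam : 'I_n -> R).
Implicit Types (z : R * R) (i j : 'I_n) (x y : 'M[R]_(n, 2)).

(** The parameter u of the flex enters only through the point
    ((1 - u^2) / (1 + u^2), 2u / (1 + u^2)), which also makes sense at infinity. *)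
Definition circle : set (R * R) := [set z | z.1 ^+ 2 + z.2 ^+ 2 = 1].

(** The diagonal is 0 because the inverse of 0 is 0. *)
Definition eps : 'M[R]_n :=
  \matrix_(i, j) (2 * lam i * lam j / (lam i ^+ 2 - lam j ^+ 2)).

(** For z the point of parameter u, this is 2 (1 + lam_i^2 u^2) / (1 + u^2);
    [flex_cos] and [flex_sin] are the coordinates of the point of parameter
    lam_i u. *)
Definition flex_den i z : R := (1 + z.1) + lam i ^+ 2 * (1 - z.1).

Definition flex_cos i z : R := ((1 + z.1) - lam i ^+ 2 * (1 - z.1)) / flex_den i z.

Definition flex_sin i z : R := 2 * lam i * z.2 / flex_den i z.

Definition apex_scale i : R := (Num.sqrt (1 + dotp (row i eps) (row i eps)))^-1.

(** The a_i are an orthonormal basis at height 0; each b_i turns about the span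
    of the a_j with j different from i. *)
Definition flex_vertex z (v : vertex n) : 'rV[R]_n.+1 :=
  if v.2 == 0 then lift_height 0 (delta_mx 0 v.1)
  else apex_scale v.1 *: lift_height (flex_sin v.1 z) (row v.1 eps - flex_cos v.1 z *: delta_mx 0 v.1).

Lemma eps_antisym i j : eps i j = - eps j i.
Proof. by rewrite !mxE -opprB invrN mulrN (mulrAC 2). Qed.

Lemma eps_diag i : eps i i = 0.
Proof. by rewrite mxE subrr invr0 mulr0. Qed.

Lemma eps_quadratic_form0 (b : 'I_n -> R) : \sum_i \sum_j b i * b j * eps i j = 0.
Proof.
set s := LHS; have : s = - s.
  rewrite /s [LHS]exchange_big -sumrN; apply: eq_bigr => i _; rewrite -sumrN.
  by apply: eq_bigr => j _; rewrite eps_antisym mulrN (mulrC (b j)).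
by move=> ss; lra.
Qed.

Lemma apex_scale_gt0 i : 0 < apex_scale i.
Proof. by rewrite invr_gt0 sqrtr_gt0 ltr_wpDr ?dotp_ge0. Qed.

Lemma apex_scale_sqr i : apex_scale i ^+ 2 * (1 + dotp (row i eps) (row i eps)) = 1.
Proof.
have ge0 : 0 < 1 + dotp (row i eps) (row i eps) by rewrite ltr_wpDr ?dotp_ge0.
by rewrite exprVn sqr_sqrtr ?mulVf ?gt_eqF // ltW.
Qed.

Lemma dotp_delta (w : 'rV[R]_n) i : dotp w (delta_mx 0 i) = w 0 i.
Proof.
rewrite dotpE (bigD1 i) //= mxE !eqxx mulr1 big1 ?addr0 // => j ji.
by rewrite mxE (negPf ji) mulr0.
Qed.

Hypothesis lam_gt0 : forall i, 0 < lam i.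
Hypothesis lam_inj : injective lam.

Lemma circle_bounds z : circle z -> -1 <= z.1 <= 1.
Proof. by rewrite /circle /= => z1; have z2 := sqr_ge0 z.2; apply/andP; split; nra. Qed.

Lemma flex_den_gt0 i z : circle z -> 0 < flex_den i z.
Proof.
move=> /circle_bounds /andP[zl zu]; have l0 := lam_gt0 i.
have l2 : 0 < lam i ^+ 2 by rewrite exprn_gt0.
have l2z : 0 <= lam i ^+ 2 * (1 - z.1) by rewrite mulr_ge0 ?subr_ge0 // ltW.
by rewrite /flex_den; case: (lerP z.1 0) => z0; nra.
Qed.

Lemma flex_cos2Dsin2 i z : circle z -> flex_cos i z ^+ 2 + flex_sin i z ^+ 2 = 1.
Proof.
move=> zC; have d0 := flex_den_gt0 i zC; rewrite /flex_cos /flex_sin !exprMn exprVn -mulrDl.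
apply: (canLR (mulfK _)); first by rewrite gt_eqF // exprn_gt0.
rewrite mul1r /flex_den; move: zC; rewrite /circle /= => zC.
have -> : z.2 ^+ 2 = 1 - z.1 ^+ 2 by lra.
ring.
Qed.

(** This identity determines [eps]: it makes the scalar products of the b_i
    independent of [z]. *)
Lemma flex_relation i j z : circle z -> i != j ->
  flex_sin i z * flex_sin j z = eps i j * (flex_cos j z - flex_cos i z).
Proof.
move=> zC ij; have di := flex_den_gt0 i zC; have dj := flex_den_gt0 j zC.
have lij : lam i ^+ 2 - lam j ^+ 2 != 0.
  by rewrite subr_eq0 eqrXn2 ?ltW // (inj_eq lam_inj).
have dj0 := lt0r_neq0 dj; have di0 := lt0r_neq0 di.
rewrite /flex_cos /flex_sin mxE.
have S2 : z.2 ^+ 2 = 1 - z.1 ^+ 2 by move: zC; rewrite /circle /=; lra.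
transitivity (4 * lam i * lam j * z.2 ^+ 2 / (flex_den i z * flex_den j z)).
  by field; rewrite dj0.
rewrite S2; rewrite /flex_den in dj0 di0 *; field.
by rewrite lij dj0 di0.
Qed.

Lemma flex_vertex_unit z v : circle z ->
  dotp (flex_vertex z v) (flex_vertex z v) = 1.
Proof.
move=> zC; rewrite /flex_vertex; case: ifP => _; rewrite ?dotpZl ?dotpZr dotp_lift_height.
  by rewrite mul0r add0r dotp_delta mxE !eqxx.
rewrite !(dotpDl, dotpDr, dotpNl, dotpNr, dotpZl, dotpZr) !dotp_delta.
rewrite (dotpC (delta_mx _ _)) dotp_delta !mxE !eqxx subrr invr0 !mulr0.
have := apex_scale_sqr v.1; have := flex_cos2Dsin2 v.1 zC; set c := flex_cos _ _; set s := flex_sin _ _.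
set r := apex_scale _; set q := dotp _ _ => cs rq.
transitivity (r ^+ 2 * (q + (c ^+ 2 + s ^+ 2))); first by rewrite /=; ring.
by rewrite cs addrC.
Qed.

Lemma gram_flex_vertex z z' (v w : vertex n) : circle z -> circle z' ->
  v = w \/ v.1 != w.1 ->
  dotp (flex_vertex z v) (flex_vertex z w) = dotp (flex_vertex z' v) (flex_vertex z' w).
Proof.
move=> zC z'C; suff [g gE] : exists g : vertex n -> vertex n -> R,
  forall z v w, circle z -> v = w \/ v.1 != w.1 ->
    dotp (flex_vertex z v) (flex_vertex z w) = g v w.
  by move=> vw; rewrite !gE.
exists (fun v w => if v == w then 1 else
  if v.2 == 0 then if w.2 == 0 then 0 else apex_scale w.1 * eps w.1 v.1
  else if w.2 == 0 then apex_scale v.1 * eps v.1 w.1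
  else apex_scale v.1 * apex_scale w.1 * dotp (row v.1 eps) (row w.1 eps)).
move=> {v w zC z'C z'} {}z v w zC; have [<- _|vw [/eqP|vw1]] := eqVneq v w.
- exact: flex_vertex_unit.
- by rewrite (negPf vw).
case: v w vw vw1 => [i j] [k l] /= _ ik; rewrite /flex_vertex /=.
have rowE1 a b : row a eps 0 b = eps a b by rewrite mxE.
have deltaE a b : delta_mx 0 a 0 b = (b == a)%:R :> R by rewrite mxE eqxx.
have ki : (k == i) = false by rewrite eq_sym (negPf ik).
case: ifP => _; case: ifP => _; rewrite ?dotpZl ?dotpZr !dotp_lift_height ?mul0r ?mulr0 ?add0r.
- by rewrite dotp_delta deltaE ki.
- rewrite dotpC dotpDl dotpNl dotpZl !dotp_delta rowE1 deltaE (negPf ik).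
  by rewrite mulr0 subr0.
- by rewrite dotpDl dotpNl dotpZl !dotp_delta rowE1 deltaE ki mulr0 subr0.
rewrite !(dotpDl, dotpDr, dotpNl, dotpNr, dotpZl, dotpZr) !dotp_delta.
rewrite (dotpC (delta_mx _ _)) dotp_delta !rowE1 deltaE ki flex_relation //.
rewrite (eps_antisym k i) /=; move: (eps i k) (flex_cos k z) (flex_cos i z) (dotp _ _).
by move: (apex_scale i) (apex_scale k) => r r' e c c' d; ring.
Qed.

Lemma cone_map_tail z x k :
  cone_map (flex_vertex z) x 0 (tail_index k) =
  x k 0 - flex_cos k z * (apex_scale k * x k 1) + \sum_i apex_scale i * x i 1 * eps i k.
Proof.
have v0 i : flex_vertex z (i, 0) 0 (tail_index k) = (k == i)%:R.
  by rewrite /flex_vertex lift_tail mxE eqxx.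
have v1 i : flex_vertex z (i, 1) 0 (tail_index k) =
    apex_scale i * (eps i k - flex_cos i z * (k == i)%:R).
  by rewrite /flex_vertex mxE lift_tail !mxE eqxx.
have pick (F : 'I_n -> R) : \sum_i F i * (k == i)%:R = F k.
  rewrite (bigD1 k) //= eqxx mulr1 big1 ?addr0 // => i ik.
  by rewrite eq_sym (negPf ik) mulr0.
rewrite cone_mapE big_vertex -addrA.
under eq_bigr do rewrite v0 v1 /=.
rewrite big_split /= pick; congr (_ + _).
rewrite -(pick (fun k => flex_cos k z * (apex_scale k * x k 1))) addrC -sumrB.
by apply: eq_bigr => i _; ring.
Qed.

(** With b the rescaled weights on the b_i, pairing the tail with b gives
    0 = sum_k (x_k0 b_k - c_k b_k^2), the [eps] part being an antisymmetric form.
    All summands are nonpositive. *)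
Lemma tail_injective z x :
  (forall i, 0 < flex_cos i z) -> (forall i, x i 0 * x i 1 <= 0) ->
  (forall k, cone_map (flex_vertex z) x 0 (tail_index k) = 0) -> x = 0.
Proof.
move=> c0 x01 x0; pose b k := apex_scale k * x k 1.
have bE k : b k = 0 -> x k 1 = 0.
  by move/eqP; rewrite mulf_eq0 gt_eqF ?apex_scale_gt0 //= => /eqP.
have sum0 : \sum_k (flex_cos k z * b k ^+ 2 - x k 0 * b k) = 0.
  transitivity (- \sum_k b k * cone_map (flex_vertex z) x 0 (tail_index k)).
    transitivity (- \sum_k b k * cone_map (flex_vertex z) x 0 (tail_index k) +
      \sum_k \sum_i b k * b i * eps i k).
      rewrite -sumrN -big_split; apply: eq_bigr => k _ /=.
      rewrite cone_map_tail !mulrDr mulr_sumr -/(b k).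
      set s1 := \sum_i _; set s2 := \sum_i _.
      have -> : s1 = s2 by apply: eq_bigr => i _; rewrite -/(b i); ring.
      ring.
    rewrite [X in _ + X](_ : _ = 0) ?addr0 // -[RHS](eps_quadratic_form0 b) exchange_big.
    by apply: eq_bigr => i _; apply: eq_bigr => k _; rewrite (mulrC (b k)).
  by rewrite big1 ?oppr0 // => k _; rewrite x0 mulr0.
have ge0 k : 0 <= flex_cos k z * b k ^+ 2 - x k 0 * b k.
  rewrite subr_ge0 (le_trans (y := 0)) //; last by rewrite mulr_ge0 ?sqr_ge0 // ltW.
  by rewrite mulrCA pmulr_rle0 ?apex_scale_gt0.
have b0 k : b k = 0.
  have /(_ k isT) /eqP := psumr_eq0P (fun k _ => ge0 k) sum0.
  rewrite subr_eq0 => /eqP cb; apply: contrapT => /eqP bk.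
  have : 0 < flex_cos k z * b k ^+ 2 by rewrite mulr_gt0 // lt0r sqrf_eq0 bk sqr_ge0.
  by rewrite cb ltNge mulrCA pmulr_rle0 ?apex_scale_gt0 // x01.
apply/matrixP => k j; rewrite mxE; case: (ord2E j) => -> ; last exact: bE.
have := x0 k; rewrite cone_map_tail -/(b k) b0 mulr0 subr0 big1 ?addr0 // => i _.
by rewrite -/(b i) b0 mul0r.
Qed.

(** At parameter 0 all [flex_cos] are 1; the constant Gram matrix carries the
    result to the other parameters. *)
Lemma independent_flex_vertex z : circle z -> independent (flex_vertex z).
Proof.
move=> zC; have z0 : circle (1, 0) by rewrite /circle /= expr1n expr0n addr0.
apply: (independent_of_gram (p := flex_vertex (1, 0))) => [v w|x cx x0].
  exact: gram_flex_vertex.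
apply: (tail_injective (z := (1, 0))) => [i|i|k].
- by rewrite /flex_cos /flex_den /= subrr mulr0 subr0 addr0 divff.
- by rewrite cx.
- by rewrite x0 mxE.
Qed.

(** In a row of a difference of two complementary nonnegative matrices the two
    entries never have the same strict sign. *)
Lemma flex_vertex_inj z x y : (forall i, 0 < flex_cos i z) ->
  complementary x -> complementary y ->
  (forall i a, 0 <= x i a) -> (forall i a, 0 <= y i a) ->
  cone_map (flex_vertex z) x = cone_map (flex_vertex z) y -> x = y.
Proof.
move=> c0 cx cy x0 y0 xy; apply/eqP; rewrite -subr_eq0; apply/eqP.
apply: (tail_injective c0) => [i|k].
  rewrite !mxE mulrBl !mulrBr cx cy sub0r subr0 -opprD oppr_le0.
  by rewrite addr_ge0 // mulr_ge0.
by rewrite cone_mapB xy subrr mxE.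
Qed.

End Family.

(** * A contraction argument *)

Section MaxNorm.
Variables (R : realType) (p q : nat).
Implicit Types M : 'M[R]_(p, q).

Lemma entry_le_norm M i j : `|M i j| <= `|M|.
Proof.
rewrite [leRHS]/Num.norm /= mx_normrE.
exact: (le_bigmax _ (fun ij : 'I_p * 'I_q => `|M ij.1 ij.2|) (i, j)).
Qed.

Lemma norm_le_entries M a :
  0 <= a -> (forall i j, `|M i j| <= a) -> `|M| <= a.
Proof.
move=> a0 Ma; rewrite [leLHS]/Num.norm /= mx_normrE.
by apply: bigmax_le => // -[i j] _; exact: Ma.
Qed.

End MaxNorm.

HB.instance Definition _ (R : realType) (p q : nat) :=
  Complete.on 'M[R]_(p, q).

Section ComplementarySurjectivity.
Variables (R : realType) (n : nat) (E : 'M[R]_n).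
Hypothesis E_small : forall k, \sum_i `|E i k| <= 2^-1.

(** Positive and negative part solve the linear complementarity problem
    alpha - beta + beta E = q in terms of alpha - beta alone. *)
Definition negpart (y : 'rV[R]_n) : 'rV[R]_n := \row_i Num.max 0 (- y 0 i).

(** Taking negative parts is 1-Lipschitz in the maximum norm, and multiplying by
    [E] contracts by the bound on its column sums. *)
Lemma complementary_fixed_point (q : 'rV[R]_n) :
  exists y : 'rV[R]_n, y = q - negpart y *m E.
Proof.
pose f (y : 'rV[R]_n) : 'rV[R]_n := q - negpart y *m E.
have [|||y _ yE] := @banach_fixed_point R 'rV[R]_n setT (totalfun f); last by exists y.
- exists (2^-1)%:nng; split; first by rewrite /= invf_lt1 ?ltr1n.
  move=> [y y'] _ /=; rewrite /totalfun_ /f opprB addrC addrA subrK -mulmxBl.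
  apply: norm_le_entries => [|i k]; first by rewrite mulr_ge0.
  rewrite mxE (le_trans (ler_norm_sum _ _ _)) // mulrC.
  apply: (le_trans (y := \sum_l `|y - y'| * `|E l k|)); last first.
    by rewrite -mulr_sumr ler_wpM2l.
  apply: ler_sum => l _; rewrite normrM ler_wpM2r //.
  apply: le_trans (entry_le_norm (y - y') 0 l); rewrite !mxE.
  have := ler_norm (y' 0 l - y 0 l); rewrite distrC => ?.
  have ? := ler_norm (y 0 l - y' 0 l).
  rewrite ler_norml; apply/andP.
  by case: (lerP 0 (- y' 0 l)) => ?; case: (lerP 0 (- y 0 l)) => ?; split; lra.
- exact: closedT.
- by exists 0.
Qed.
End ComplementarySurjectivity.

(** * Moving the family into the hemispheres *)

Section Coordinates.
Variables (R : realType) (n : nat).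

Lemma lift_heightP (y : 'rV[R]_n.+1) : exists h t, y = lift_height h t.
Proof.
exists (y 0 (lshift n (0 : 'I_1))), (rsubmx (y : 'rV_(1 + n))).
apply: etrans (esym (hsubmxK (y : 'rV_(1 + n)))) _; congr row_mx.
by apply/rowP => i; rewrite !mxE ord1 mulr1n.
Qed.

Lemma lift_heightD h t h' t' :
  lift_height h t + lift_height h' t' = lift_height (h + h') (t + t') :> 'rV[R]_n.+1.
Proof.
rewrite /lift_height raddfD /=.
exact: (add_row_mx (h%:M : 'M[R]_1) t h'%:M t').
Qed.

Lemma lift_heightZ a h t :
  a *: lift_height h t = lift_height (a * h) (a *: t) :> 'rV[R]_n.+1.
Proof.
rewrite /lift_height -scale_scalar_mx.
exact: (scale_row_mx a (h%:M : 'M[R]_1) t).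
Qed.

Lemma lift_height0 : lift_height 0 0 = 0 :> 'rV[R]_n.+1.
Proof. by rewrite /lift_height raddf0; exact: (@row_mx0 R 1 1 n). Qed.

Lemma lift_height_sum (I : finType) (h : I -> R) (t : I -> 'rV[R]_n) :
  \sum_i lift_height (h i) (t i) = lift_height (\sum_i h i) (\sum_i t i).
Proof.
elim/big_rec3: _ => [|i a b y _ ->]; first by rewrite lift_height0.
by rewrite lift_heightD.
Qed.

Lemma sum_facet0 (V : nmodType) (F : vertex n -> V) :
  \sum_(v in facet finset.set0) F v = \sum_i F (i, 0).
Proof.
rewrite /facet big_imset /= => [|i j _ _]; last exact: side_inj.
by apply: eq_big => [i|i _]; rewrite ?inE // /side finset.in_set0.
Qed.

Lemma sum_ridge0 (V : nmodType) (F : vertex n -> V) k :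
  \sum_(v in ridge finset.set0 k) F v = \sum_(i | i != k) F (i, 0).
Proof.
rewrite /ridge big_imset /= => [|i j _ _]; last exact: side_inj.
by apply: eq_big => [i|i _]; rewrite ?inE // /side finset.in_set0.
Qed.

End Coordinates.

Section TiltedFamily.
Variables (R : realType) (n : nat) (lam : 'I_n -> R) (eta : R).
Variables (m : 'rV[R]_n.+1) (O : 'M[R]_n.+1).
Hypothesis lam_gt0 : forall i, 0 < lam i.
Hypothesis lam_le1 : forall i, lam i <= 1.
Hypothesis lam_inj : injective lam.
Hypothesis eps_small : forall k, \sum_i `|eps lam i k| <= 2^-1.
Hypothesis eta_gt0 : 0 < eta.
Hypothesis eta_lam : forall i, 8 * eta <= lam i.
Hypothesis eta_n : 2 * n%:R * eta ^+ 2 <= 1.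
Hypothesis O_orth : O *m O^T = 1%:M.
Hypothesis O_m : lift_height 1 0 *m O = - m.
Implicit Types (z : R * R) (i j k : 'I_n) (x y : 'M[R]_(n, 2)).

Local Notation circle := (@circle R).

(** The slope is odd in u and vanishes at 0 and at infinity, where the polyhedron
    already lies at height 0. *)
Definition tilt z : 'rV[R]_n.+1 := lift_height 1 (const_mx (eta * z.2)).

Definition frame z : 'M[R]_n.+1 := reflection (tilt z) *m O.

Definition tilted_vertex z v : 'rV[R]_n.+1 := flex_vertex lam z v *m frame z.

Lemma dotp_const (t : 'rV[R]_n) a : dotp t (const_mx a) = a * \sum_k t 0 k.
Proof. by rewrite dotpE mulr_sumr; apply: eq_bigr => k _; rewrite mxE mulrC. Qed.

Lemma dotp_tilt z : dotp (tilt z) (tilt z) = 1 + n%:R * (eta * z.2) ^+ 2.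
Proof.
rewrite dotp_lift_height dotp_const (eq_bigr (fun=> eta * z.2)) => [|k _]; last by rewrite mxE.
by rewrite sumr_const card_ord -mulr_natr; ring.
Qed.

Lemma dotp_tilt_gt0 z : 0 < dotp (tilt z) (tilt z).
Proof. by rewrite dotp_tilt ltr_wpDr // mulr_ge0 ?sqr_ge0. Qed.

Lemma tilt_neq0 z : tilt z != 0.
Proof. by rewrite -dotp_gt0 dotp_tilt_gt0. Qed.

Lemma frame_orthogonal z : frame z *m (frame z)^T = 1%:M.
Proof.
rewrite /frame trmx_mul -mulmxA (mulmxA O) O_orth mul1mx.
exact: reflection_orthogonal (tilt_neq0 z).
Qed.

(** Up to the positive factor [dotp (tilt z) (tilt z)], the height over [m]
    of a vector moved by [frame z] is the scalar product of this vector with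
    (1 - n tau^2) e_0 + 2 tau (e_1 + ... + e_n) where tau = eta z.2. *)
Lemma height_frame z h t :
  dotp (lift_height h t *m frame z) m * dotp (tilt z) (tilt z) =
  (1 - n%:R * (eta * z.2) ^+ 2) * h + 2 * eta * z.2 * \sum_k t 0 k.
Proof.
have mE : m *m O^T = - lift_height 1 0.
  by rewrite -[m]opprK -O_m mulNmx -mulmxA O_orth mulmx1.
have w0 := lt0r_neq0 (dotp_tilt_gt0 z).
have dot0 (y : 'rV[R]_n) : dotp y 0 = 0 by rewrite dotpC /dotp mul0mx mxE.
have DE := dotp_tilt z; set D := dotp (tilt z) (tilt z) in w0 DE *.
rewrite /frame mulmxA dotp_mulmx mE dotpNr mulmx_reflection -/D.
rewrite dotpDl dotpNl dotpZl !dotp_lift_height !dot0 dotp_const !addr0 !mulr1.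
move: (\sum_k _) => s; transitivity (2 * (h + eta * z.2 * s) - h * D).
  by field.
by rewrite DE; ring.
Qed.

Lemma sum_eps_bound i : `|\sum_k eps lam i k| <= 2^-1.
Proof.
apply: le_trans (ler_norm_sum _ _ _) _; apply: le_trans (eps_small i).
by apply: ler_sum => k _; rewrite eps_antisym normrN.
Qed.

Lemma sum_delta i : \sum_k (delta_mx 0 i : 'rV[R]_n) 0 k = 1.
Proof.
rewrite (bigD1 i) //= mxE !eqxx big1 ?addr0 // => k ki.
by rewrite mxE (negPf ki) andbF.
Qed.

(** Every height is z.2 times a positive number.  For a_i the tilt alone gives
    2 tau.  For b_i the leading term is s_i, which is z.2 times a number bounded
    below in terms of lam_i, while tau contributes at most a multiple of eta,
    chosen small compared with lam_i. *)
Lemma tilted_vertex_height z v : circle z ->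
  exists2 g, 0 < g & dotp (tilted_vertex z v) m = z.2 * g.
Proof.
move=> zC; have D0 := dotp_tilt_gt0 z; have := @height_frame z.
set D := dotp (tilt z) (tilt z) in D0 * => hf.
suff [g g0 gE] : exists2 g, 0 < g & dotp (tilted_vertex z v) m * D = z.2 * g.
  exists (g / D); first by rewrite divr_gt0.
  by rewrite mulrA -gE mulfK // lt0r_neq0.
case: v => i j; case: (ord2E j) => ->.
  exists (2 * eta); first by rewrite mulr_gt0.
  by rewrite /tilted_vertex /flex_vertex /= hf sum_delta; ring.
have r0 := apex_scale_gt0 lam i; have d0 := flex_den_gt0 lam_gt0 i zC.
rewrite /tilted_vertex /flex_vertex /= -scalemxAl dotpZl -mulrA hf.
exists (apex_scale lam i * (2 * ((1 - n%:R * (eta * z.2) ^+ 2) * (lam i / flex_den lam i z) +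
   eta * (\sum_k eps lam i k - flex_cos lam i z)))).
  rewrite pmulr_rgt0 // pmulr_rgt0 //.
  have l0 := lam_gt0 i; have l1 := lam_le1 i.
  have /andP[zl zu] := circle_bounds zC.
  have z2 : z.2 ^+ 2 <= 1 by move: zC; rewrite /circle /= => <-; rewrite lerDr sqr_ge0.
  (* The factor of s_i loses at most one half, and s_i = z.2 (2 lam_i / flex_den)
     is at least z.2 lam_i in absolute value. *)
  have half : 2^-1 <= 1 - n%:R * (eta * z.2) ^+ 2.
    have n0 : 0 <= n%:R * eta ^+ 2 by rewrite mulr_ge0 ?sqr_ge0.
    have -> : n%:R * (eta * z.2) ^+ 2 = n%:R * eta ^+ 2 * z.2 ^+ 2 by ring.
    have := ler_wpM2l n0 z2; move: eta_n; rewrite -mulrA; move: (n%:R * _) => q; lra.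
  have den2 : flex_den lam i z <= 2.
    rewrite /flex_den; have : lam i ^+ 2 * (1 - z.1) <= 1 - z.1.
      by rewrite ler_piMl ?subr_ge0 // exprn_ile1 // ltW.
    lra.
  have ld : lam i / 2 <= lam i / flex_den lam i z.
    by rewrite ler_wpM2l ?lef_pV2 ?posrE // ltW.
  have : 2^-1 * (lam i / 2) <=
      (1 - n%:R * (eta * z.2) ^+ 2) * (lam i / flex_den lam i z).
    by rewrite ler_pM // ?invr_ge0 // divr_ge0 // ltW.
  have c1 : flex_cos lam i z <= 1.
    have c2 := flex_cos2Dsin2 lam_gt0 i zC; have s2 := sqr_ge0 (flex_sin lam i z).
    by nra.
  have := sum_eps_bound i; rewrite ler_norml => /andP[e1 _].
  have e8 := eta_lam i.
  move: ((1 - _) * (lam i / _)) (\sum_k _) (flex_cos _ _ _) e1 c1 => a s c e1 c1 la.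
  have : eta * (- 2^-1 - 1) <= eta * (s - c) by rewrite ler_wpM2l ?(ltW eta_gt0) //; lra.
  lra.
have -> : \sum_k (row i (eps lam) - flex_cos lam i z *: delta_mx 0 i) 0 k =
    \sum_k eps lam i k - flex_cos lam i z.
  rewrite -[flex_cos lam i z in RHS]mulr1 -(sum_delta i) mulr_sumr -sumrB.
  by apply: eq_bigr => k _; rewrite !mxE.
rewrite /flex_sin; field; exact: lt0r_neq0.
Qed.

Lemma dotp_tilted_vertex z v w :
  dotp (tilted_vertex z v) (tilted_vertex z w) =
  dotp (flex_vertex lam z v) (flex_vertex lam z w).
Proof. exact/dotp_orthogonal/frame_orthogonal. Qed.

Lemma gram_tilted_vertex z z' v w : circle z -> circle z' ->
  v = w \/ v.1 != w.1 ->
  dotp (tilted_vertex z v) (tilted_vertex z w) =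
  dotp (tilted_vertex z' v) (tilted_vertex z' w).
Proof. by move=> zC z'C vw; rewrite !dotp_tilted_vertex; exact: gram_flex_vertex. Qed.

Lemma tilted_vertex_unit z v : circle z ->
  dotp (tilted_vertex z v) (tilted_vertex z v) = 1.
Proof. by move=> zC; rewrite dotp_tilted_vertex flex_vertex_unit. Qed.

Lemma independent_tilted_vertex z : circle z -> independent (tilted_vertex z).
Proof.
move=> zC; apply: (independent_of_gram (p := flex_vertex lam z)) => [v w _|].
  by rewrite dotp_tilted_vertex.
exact: independent_flex_vertex.
Qed.

Lemma body_height z (y : 'rV[R]_n.+1) :
  circle z -> body (radial_map (tilted_vertex z)) y ->
  exists2 g, 0 < g & dotp y m = z.2 * g.
Proof.
move=> zC [x xK <-].
have /sqrt_dotp_gt0 c0 := cone_map_neq0 (independent_tilted_vertex zC) xK.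
have heightP v : exists g, 0 < g /\ dotp (tilted_vertex z v) m = z.2 * g.
  by have [g] := tilted_vertex_height v zC; exists g.
have [g gE] := choice heightP.
exists ((Num.sqrt (dotp (cone_map (tilted_vertex z) x) (cone_map (tilted_vertex z) x)))^-1
   * \sum_v x v.1 v.2 * g v); last first.
  rewrite /radial_map /normalize dotpZl mulrCA; congr (_ * _).
  rewrite dotp_cone_map mulr_sumr.
  by apply: eq_bigr => v _; rewrite (gE v).2 mulrCA.
rewrite mulr_gt0 ?invr_gt0 //.
have /realizationP[x0 _ _] := xK.
have t0 v : 0 <= x v.1 v.2 * g v by rewrite mulr_ge0 // ltW // (gE v).1.
rewrite lt0r sumr_ge0 // andbT; apply: contra (realization_neq0 xK) => /eqP /psumr_eq0P s0.
apply/eqP/matrixP => i j; rewrite mxE; have /eqP := s0 (fun v _ => t0 v) (i, j) isT.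
by rewrite mulf_eq0 (gt_eqF (gE _).1) orbF => /eqP.
Qed.

Lemma frame_inj z (y y' : 'rV[R]_n.+1) : y *m frame z = y' *m frame z -> y = y'.
Proof.
move=> /(congr1 (fun w => w *m (frame z)^T)).
by rewrite -2!(mulmxA _ (frame z)) frame_orthogonal !mulmx1.
Qed.

Lemma tilted_embedding z :
  circle z -> 0 < z.1 -> embedding (radial_map (tilted_vertex z)).
Proof.
move=> zC z0; apply: radial_map_embedding.
  exact: independent_tilted_vertex.
move=> x y cx cy x0 y0; rewrite !cone_map_mulmx => /frame_inj.
apply: flex_vertex_inj => // i; rewrite divr_gt0 ?flex_den_gt0 // subr_gt0.
have /andP[zl zu] := circle_bounds zC.
apply: le_lt_trans (_ : 1 - z.1 < _); last by lra.
by rewrite ler_piMl ?subr_ge0 // exprn_ile1 // ltW.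
Qed.

Lemma eps_neq0 i j : i != j -> eps lam i j != 0.
Proof.
move=> ij; have l0 k : lam k != 0 by rewrite lt0r_neq0.
rewrite mxE; apply: mulf_neq0; first by rewrite !mulf_neq0.
by rewrite invr_eq0 subr_eq0 eqrXn2 ?ltW // (inj_eq lam_inj).
Qed.

(** The a_k with k different from i have no component along e_i, whereas that of
    b_j is a nonzero multiple of eps_ji. *)
Lemma tilted_nondegenerate z : (2 <= n)%N -> circle z ->
  nondegenerate_polyhedron (radial_map (tilted_vertex z)).
Proof.
move=> n2 zC; apply: radial_map_nondegenerate => //.
- by move=> v; exact: tilted_vertex_unit.
- exact: independent_tilted_vertex.
move=> i; have [j ji] : exists j, j != i.
  have : (0 < #|[set~ i]%SET|)%N by rewrite cardsC1 card_ord; lia.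
  by move=> /card_gt0P[j]; rewrite !inE; exists j.
exists j => // c; rewrite sum_ridge0 /tilted_vertex.
under eq_bigr do rewrite scalemxAl; rewrite -mulmx_suml => /frame_inj.
move=> /(congr1 (fun y : 'rV[R]_n.+1 => y 0 (tail_index i))).
rewrite summxE big1 => [|k ki]; last first.
  by rewrite mxE /flex_vertex /= lift_tail mxE (eq_sym i) (negPf ki) mulr0.
rewrite /flex_vertex mxE lift_tail !mxE (eq_sym i) (negPf ji) mulr0 subr0 => /eqP.
rewrite mulf_eq0 gt_eqF ?apex_scale_gt0 //=.
by have := eps_neq0 ji; rewrite mxE => /negPf ->.
Qed.

(** When lam_i is largest, row i of [eps] is nonnegative; at infinity b_i is the
    corresponding nonnegative combination of the a_k. *)
Lemma tilted_not_embedded i : (forall k, lam k <= lam i) ->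
  ~ embedded (radial_map (tilted_vertex (-1, 0))).
Proof.
move=> li; have zC : circle (-1, 0) by rewrite /circle /= sqrrN expr1n expr0n addr0.
apply: (@radial_map_not_embedded _ _ _ _ i
  (fun v => apex_scale lam i * (eps lam i v.1 + (v.1 == i)%:R))).
- by move=> v; exact: tilted_vertex_unit.
- move=> v; rewrite mulr_ge0 ?(ltW (apex_scale_gt0 _ _)) // addr_ge0 ?ler0n // mxE.
  have l0 k : 0 <= lam k by exact: ltW.
  apply: divr_ge0; first by rewrite !mulr_ge0 ?ler0n.
  by rewrite subr_ge0 lerXn2r ?nnegrE.
- rewrite sum_facet0 /tilted_vertex /=; under eq_bigr do rewrite scalemxAl.
  rewrite -mulmx_suml; congr (_ *m _); rewrite /flex_vertex /=.
  under eq_bigr do rewrite lift_heightZ.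
  rewrite lift_height_sum lift_heightZ; congr lift_height.
    by rewrite /flex_sin /= mulr0 mul0r mulr0 big1 // => k _; rewrite mulr0.
  apply/rowP => k; rewrite mxE summxE (bigD1 k) //= big1 => [|l lk]; last first.
    by rewrite !mxE (eq_sym k) (negPf lk) andbF mulr0.
  have -> : flex_cos lam i (-1, 0) = -1.
    rewrite /flex_cos /flex_den /= subrr opprK sub0r add0r mulNr divff // mulf_neq0 //.
      by rewrite expf_neq0 // lt0r_neq0.
  by rewrite addr0 scaleN1r opprK mxE [row _ _ _ _]mxE [delta_mx _ _ _ _]mxE
    [(_ *: delta_mx _ _) _ _]mxE [delta_mx _ _ _ _]mxE !eqxx mulr1.
Qed.

(** The positive part of the fixed point gives the weights on the a_i, its
    negative part those on the b_i. *)
Lemma tail_surjective (q : 'rV[R]_n) : exists x,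
  [/\ forall i a, 0 <= x i a, complementary x &
      cone_map (flex_vertex lam (1, 0)) x = lift_height 0 q].
Proof.
have [y yE] := complementary_fixed_point eps_small q.
pose x : 'M[R]_(n, 2) := \matrix_(i, j)
  if j == 0 then Num.max 0 (y 0 i) else Num.max 0 (- y 0 i) / apex_scale lam i.
have xi0 i : x i 0 = Num.max 0 (y 0 i) by rewrite mxE.
have xi1 i : apex_scale lam i * x i 1 = negpart y 0 i.
  by rewrite !mxE mulrC divfK // lt0r_neq0 // apex_scale_gt0.
exists x; split=> [i j|i|].
- rewrite mxE; case: ifP => _; first by rewrite le_max lexx.
  by rewrite divr_ge0 ?(ltW (apex_scale_gt0 _ _)) // le_max lexx.
- rewrite xi0 mxE /=; case: (lerP 0 (y 0 i)) => y0; last by rewrite mul0r.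
  by rewrite max_l ?oppr_le0 // mul0r mulr0.
have [h [t xE]] := lift_heightP (cone_map (flex_vertex lam (1, 0)) x).
have h0 : h = 0.
  rewrite -(lift_head h t) -xE cone_mapE big1 // => -[i j] _.
  rewrite /flex_vertex /=; case: ifP => _; first by rewrite lift_head mulr0.
  by rewrite lift_heightZ lift_head /flex_sin /= mulr0 mul0r !mulr0.
rewrite xE h0; congr lift_height; apply/rowP => k.
rewrite -(lift_tail h t) -xE cone_map_tail xi0 xi1.
have -> : flex_cos lam k (1, 0) = 1.
  by rewrite /flex_cos /flex_den /= subrr mulr0 subr0 addr0 divff.
have -> : \sum_i apex_scale lam i * x i 1 * eps lam i k = (negpart y *m eps lam) 0 k.
  by rewrite mxE; apply: eq_bigr => i _; rewrite xi1.
rewrite mul1r (_ : q = y + negpart y *m eps lam); last by rewrite {1}yE subrK.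
rewrite [in RHS]mxE; congr (_ + _); rewrite [negpart _ _ _]mxE.
by case: (lerP 0 (y 0 k)) => ?; case: (lerP 0 (- y 0 k)) => ?; lra.
Qed.

Lemma tilted_equator : body (radial_map (tilted_vertex (1, 0))) = equator m.
Proof.
have zC : circle (1, 0) by rewrite /circle /= expr1n expr0n addr0.
have ip := independent_tilted_vertex zC.
apply/seteqP; split=> y.
  move=> yB; have [g _ yE] := body_height zC yB.
  by split; [exact: (radial_map_sphere ip)|rewrite yE mul0r].
move=> [y1 ym].
have [h [q yE]] := lift_heightP (y *m (frame (1, 0))^T).
have {}yE : y = lift_height h q *m frame (1, 0).
  by rewrite -yE -mulmxA (mulmx1C (frame_orthogonal _)) mulmx1.
have h0 : h = 0.
  have := height_frame (1, 0) h q; rewrite -yE ym /= !(mulr0, mul0r) expr0n.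
  by rewrite mulr0 subr0 mul1r addr0 => <-.
have [x [x0 cx xE]] := tail_surjective q.
have yx : cone_map (tilted_vertex (1, 0)) x = y.
  by rewrite cone_map_mulmx xE yE h0.
have xn0 : x != 0.
  apply: contra_eq_neq y1 => x00; rewrite -yx x00 -(scale0r x) cone_mapZ scale0r.
  by rewrite /dotp mul0mx mxE eq_sym oner_eq0.
have m0 := mass_gt0 x0 xn0.
exists ((mass x)^-1 *: x); last first.
  by rewrite /radial_map cone_mapZ normalizeZ ?invr_gt0 // yx normalize_id.
apply/realizationP; split=> [i j|i|].
- by rewrite mxE mulr_ge0 // invr_ge0 ltW.
- by rewrite !mxE mulrACA cx mulr0.
- by rewrite massZ mulVf // gt_eqF.
Qed.

(** The determinant does not depend on [z], which lets determinants of vertices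
    distinguish members of the family. *)
Lemma det_frame z : \det (frame z) = - \det O.
Proof. by rewrite det_mulmx det_reflection ?tilt_neq0 // mulN1r. Qed.

Lemma det_facet_apex z i : 
  \det (col_mx (flex_vertex lam z (i, 1))
          (\matrix_k flex_vertex lam z (k, 0)) : 'M[R]_(1 + n)) =
  apex_scale lam i * flex_sin lam i z.
Proof.
have -> : \matrix_k flex_vertex lam z (k, 0) = row_mx 0 1%:M :> 'M[R]_(n, 1 + n).
  apply/row_matrixP => k; rewrite rowK.
  rewrite row_row_mx /flex_vertex /= /lift_height row1 row0.
  by rewrite raddf0.
rewrite /flex_vertex /= lift_heightZ /lift_height.
apply: etrans (det_ublock _ _ _) _.
by rewrite det1 mulr1 det_mx11 mxE eqxx.
Qed.

(** For lam_i = 1 the pair (c_i, s_i) is [z] itself.  The first coordinate is read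
    off from the scalar product of a_i and b_i; the second from the determinant
    of b_i, a_1, ..., a_n, the only step using that the congruence preserves
    orientation. *)
Lemma tilted_not_congruent z z' i : circle z -> circle z' -> lam i = 1 ->
  congruent (radial_map (tilted_vertex z)) (radial_map (tilted_vertex z')) ->
  z = z'.
Proof.
move=> zC z'C li [A [AA detA]].
have vertsE w (wC : circle w) :=
  vertices_radial_map (fun v => tilted_vertex_unit v wC).
rewrite !vertsE // => zz'.
have di w : flex_den lam i w = 2 by rewrite /flex_den li expr1n; ring.
have ci w : flex_cos lam i w = w.1 by rewrite /flex_cos di li expr1n; field.
have si w : flex_sin lam i w = w.2 by rewrite /flex_sin di li; field.
have b0 := lt0r_neq0 (apex_scale_gt0 lam i).
have dot_apex w : dotp (tilted_vertex w (i, 0)) (tilted_vertex w (i, 1)) =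
    - apex_scale lam i * w.1.
  rewrite dotp_tilted_vertex /flex_vertex /= dotpZr dotp_lift_height mul0r add0r.
  by rewrite dotpC dotp_delta !mxE !eqxx subrr invr0 mulr0 ci /=; ring.
have z1 : z'.1 = z.1.
  apply: (mulfI (x := - apex_scale lam i)); first by rewrite oppr_eq0.
  by rewrite -!dot_apex !zz' dotp_orthogonal.
have z2 : z'.2 = z.2.
  have detO : \det O != 0.
    apply: contraNneq (oner_neq0 R) => detO; rewrite -(det1 R n.+1) -O_orth.
    by rewrite det_mulmx detO mul0r.
  (* All rows of [V] are vertices, so the congruence acts on it by multiplication. *)
  pose V w : 'M[R]_n.+1 := col_mx (flex_vertex lam w (i, 1))
          (\matrix_k flex_vertex lam w (k, 0) : 'M[R]_(n, 1 + n)).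
  have detV w : \det (V w) = apex_scale lam i * w.2 by rewrite det_facet_apex si.
  have VV : V z' *m frame z' = V z *m frame z *m A.
    have mulV w (M : 'M[R]_n.+1) : V w *m M =
        col_mx (flex_vertex lam w (i, 1) *m M)
          (\matrix_k (flex_vertex lam w (k, 0) *m M) : 'M[R]_(n, 1 + n)).
      have <- : (\matrix_k flex_vertex lam w (k, 0) : 'M[R]_(n, 1 + n)) *m M =
          \matrix_k (flex_vertex lam w (k, 0) *m M).
        by apply/row_matrixP => k; rewrite row_mul !rowK.
      exact: (@mul_col_mx R 1 n (1 + n) (1 + n)).
    have zz v : flex_vertex lam z' v *m frame z' =
        flex_vertex lam z v *m (frame z *m A) by rewrite mulmxA; exact: zz'.
    rewrite -mulmxA !mulV zz.
    by under eq_mx do rewrite zz.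
  have := congr1 determinant VV.
  rewrite (det_mulmx (V z')) (det_mulmx (V z *m frame z)) (det_mulmx (V z)).
  rewrite detA mulr1 !det_frame !detV => /mulIf zz.
  by apply: (mulfI b0); apply: zz; rewrite oppr_eq0.
by rewrite [z]surjective_pairing [z']surjective_pairing z1 z2.
Qed.
End TiltedFamily.

(** * Continuity along the projective line *)

Section ScalarContinuity.
Variables (R : realType) (T : topologicalType) (t : T).

Lemma continuous_at_cst (a : R) : {for t, continuous (fun=> a)}.
Proof. exact: cst_continuous. Qed.

Lemma continuous_atD (f g : T -> R) : {for t, continuous f} -> {for t, continuous g} ->
  {for t, continuous (fun u => f u + g u)}.
Proof. exact: continuousD. Qed.

Lemma continuous_atN (f : T -> R) : {for t, continuous f} ->
  {for t, continuous (fun u => - f u)}.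
Proof. exact: continuousN. Qed.

Lemma continuous_atM (f g : T -> R) : {for t, continuous f} -> {for t, continuous g} ->
  {for t, continuous (fun u => f u * g u)}.
Proof. exact: continuousM. Qed.

Lemma continuous_atV (f : T -> R) : f t != 0 -> {for t, continuous f} ->
  {for t, continuous (fun u => (f u)^-1)}.
Proof. exact: continuousV. Qed.

Lemma eq_continuous_at (f g : T -> R) : f =1 g ->
  {for t, continuous g} -> {for t, continuous f}.
Proof. by move=> /funext ->. Qed.

End ScalarContinuity.

Section Continuity.
Variables (R : realType) (n : nat) (lam : 'I_n -> R) (eta : R).
Variables (O : 'M[R]_n.+1).
Hypothesis lam_gt0 : forall i, 0 < lam i.
Variables (T : topologicalType) (z : T -> R * R) (t : T).
Hypothesis zC : forall u, circle (z u).
Hypothesis z1_cont : {for t, continuous (fun u => (z u).1)}.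
Hypothesis z2_cont : {for t, continuous (fun u => (z u).2)}.

Lemma head_or_tail (l : 'I_n.+1) : l = head_index n \/ exists k, l = tail_index k.
Proof.
case: (@fintype.split_ordP 1 n l) => j lE; last by right; exists j.
by left; rewrite lE (ord1 j).
Qed.

Let subE d (x y : 'rV[R]_d) k : (x - y) 0 k = x 0 k - y 0 k.
Proof. by rewrite !mxE. Qed.

Let scaleE d a (x : 'rV[R]_d) k : (a *: x) 0 k = a * x 0 k.
Proof. by rewrite mxE. Qed.

Let constant_cont (a : R) : {for t, continuous (fun _ : T => a)}.
Proof. exact: continuous_at_cst. Qed.

Let den_cont i : {for t, continuous (fun u => (flex_den lam i (z u))^-1)}.
Proof.
apply: continuous_atV; first by rewrite lt0r_neq0 // flex_den_gt0.
by apply: continuous_atD; [apply: continuous_atD|apply: continuous_atM => //; apply: continuous_atD => //; exact: continuous_atN].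
Qed.

Let cosv_cont i : {for t, continuous (fun u => flex_cos lam i (z u))}.
Proof.
apply: continuous_atM => //; apply: continuous_atD; first exact: continuous_atD.
by apply: continuous_atN; apply: continuous_atM => //; apply: continuous_atD => //; exact: continuous_atN.
Qed.

Let sinv_cont i : {for t, continuous (fun u => flex_sin lam i (z u))}.
Proof. by apply: continuous_atM => //; apply: continuous_atM. Qed.

Let flex_cont v l : {for t, continuous (fun u => flex_vertex lam (z u) v 0 l)}.
Proof.
case: v => i j; case: (ord2E j) => ->; first exact: continuous_at_cst.
have [->|[k ->]] := head_or_tail l.
  rewrite (_ : (fun u => _) = fun u => apex_scale lam i * flex_sin lam i (z u)).
    exact: continuous_atM.
  by apply/funext => u; rewrite /flex_vertex /= lift_heightZ lift_head.
rewrite (_ : (fun u => _) = fun u => apex_scale lam i *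
    (row i (eps lam) 0 k - flex_cos lam i (z u) * (delta_mx 0 i : 'rV[R]_n) 0 k)).
  by apply: continuous_atM => //; apply: continuous_atD => //; apply: continuous_atN; exact: continuous_atM.
by apply/funext => u; rewrite /flex_vertex /= lift_heightZ lift_tail scaleE subE scaleE.
Qed.

Let tilt_cont l : {for t, continuous (fun u => tilt n eta (z u) 0 l)}.
Proof.
rewrite /tilt; have [->|[k ->]] := head_or_tail l.
  by apply: eq_continuous_at => [u|]; [exact: lift_head|exact: continuous_at_cst].
by apply: eq_continuous_at => [u|]; [rewrite lift_tail mxE; reflexivity|exact: continuous_atM].
Qed.

Let dotp_cont (f g : T -> 'rV[R]_n.+1) :
  (forall l, {for t, continuous (fun u => f u 0 l)}) ->
  (forall l, {for t, continuous (fun u => g u 0 l)}) ->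
  {for t, continuous (fun u => dotp (f u) (g u))}.
Proof.
move=> fc gc; apply: eq_continuous_at => [u|]; first exact: dotpE.
by apply: continuous_sumr => l; exact: continuous_atM.
Qed.

Lemma continuous_tilted_vertex v k :
  {for t, continuous (fun u => tilted_vertex lam eta O (z u) v 0 k)}.
Proof.
apply: (@eq_continuous_at _ _ _ _ (fun u => \sum_l (flex_vertex lam (z u) v 0 l -
  2 * dotp (flex_vertex lam (z u) v) (tilt n eta (z u)) /
    dotp (tilt n eta (z u)) (tilt n eta (z u)) * tilt n eta (z u) 0 l) * O l k)).
  move=> u; rewrite /tilted_vertex /frame mulmxA mxE mulmx_reflection.
  by apply: eq_bigr => l _; rewrite subE scaleE.
apply: continuous_sumr => l; apply: continuous_atM; last exact: continuous_at_cst.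
apply: continuous_atD => //; apply: continuous_atN; apply: continuous_atM => //; apply: continuous_atM.
  by apply: continuous_atM => //; exact: dotp_cont.
apply: continuous_atV; first by rewrite lt0r_neq0 // dotp_tilt_gt0.
exact: dotp_cont.
Qed.

End Continuity.

(** * The projective line as a circle *)

Section ProjectiveLine.
Variable R : realType.
Local Notation line := (one_point_compactification R).

(** Inverse stereographic projection, with the point at infinity filled in. *)
Definition line_circle (u : line) : R * R :=
  if u is Some x then ((1 - x ^+ 2) / (1 + x ^+ 2), 2 * x / (1 + x ^+ 2))
  else (-1, 0).

Let sqr1_gt0 (x : R) : 0 < 1 + x ^+ 2.
Proof. by rewrite ltr_wpDr ?sqr_ge0. Qed.

Let inv_cont (x : R) : {for x, continuous (fun y : R => (1 + y ^+ 2)^-1)}.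
Proof.
apply: continuous_atV; first exact: lt0r_neq0.
by apply: continuous_atD; [exact: continuous_at_cst|exact: exprn_continuous].
Qed.

Let first_cont (x : R) :
  {for x, continuous (fun y : R => (1 - y ^+ 2) / (1 + y ^+ 2))}.
Proof.
apply: continuous_atM; last exact: inv_cont.
by apply: continuous_atD; [exact: continuous_at_cst|apply: continuous_atN; exact: exprn_continuous].
Qed.

Let second_cont (x : R) : {for x, continuous (fun y : R => 2 * y / (1 + y ^+ 2))}.
Proof.
apply: continuous_atM; last exact: inv_cont.
by apply: continuous_atM; [exact: continuous_at_cst|exact: cvg_id].
Qed.

Lemma line_circleP u : circle (line_circle u).
Proof.
case: u => [x|]; last by rewrite /circle /= sqrrN expr1n expr0n addr0.
by have x0 := lt0r_neq0 (sqr1_gt0 x); rewrite /circle /=; field.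
Qed.

Lemma line_circle_inj : injective line_circle.
Proof.
have gt (x : R) : -1 < (1 - x ^+ 2) / (1 + x ^+ 2).
  by rewrite ltr_pdivlMr // ; lra.
move=> [x|] [y|] // [] => [xy1 xy2|xy1|xy1].
- have x0 := lt0r_neq0 (sqr1_gt0 x); have y0 := lt0r_neq0 (sqr1_gt0 y).
  have e (w : R) : 1 + w ^+ 2 != 0 ->
      w = 2 * w / (1 + w ^+ 2) / ((1 - w ^+ 2) / (1 + w ^+ 2) + 1).
    by move=> w0; field; rewrite w0; lra.
  by congr Some; rewrite (e x) // (e y) // xy1 xy2.
- by have := gt x; rewrite xy1 ltxx.
- by have := gt y; rewrite -xy1 ltxx.
Qed.

(** Neighbourhoods of infinity are complements of compact sets, so it suffices
    to control the function outside bounded intervals. *)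
Lemma continuous_line (f : line -> R) :
  continuous (fun x : R => f (Some x)) ->
  (forall e, 0 < e -> exists M, forall x, M < `|x| -> `|f (Some x) - f None| < e) ->
  continuous f.
Proof.
move=> fc finf [x|] U; first exact: fc.
move=> /nbhs_ballP[e e0 eU]; have [M fM] := finf e e0.
exists `[- M, M]%classic.
  by split; [exact: segment_compact|exact: interval_closed].
move=> _ [[x xM <-]|->]; apply: eU; last exact: ballxx.
rewrite -ball_normE /= distrC; apply: fM; rewrite ltNge; apply/negP => xM'.
by apply: xM; rewrite /= in_itv /= -ler_norml.
Qed.

Lemma line_circle1_continuous : continuous (fun u => (line_circle u).1).
Proof.
apply: continuous_line => [x|e e0] /=.
  exact: first_cont.
exists (1 + 2 / e) => x xM; have e2 : 0 < 2 / e by rewrite divr_gt0.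
have x1 : 2 / e < x ^+ 2 by rewrite -real_normK ?num_real //; nra.
have -> : (1 - x ^+ 2) / (1 + x ^+ 2) - -1 = 2 / (1 + x ^+ 2).
  by field; rewrite lt0r_neq0.
rewrite gtr0_norm ?divr_gt0 // ltr_pdivrMr //.
by move: x1; rewrite ltr_pdivrMr // => x1; lra.
Qed.

Lemma line_circle2_continuous : continuous (fun u => (line_circle u).2).
Proof.
apply: continuous_line => [x|e e0] /=.
  exact: second_cont.
exists (2 / e) => x xM; have e2 : 0 < 2 / e by rewrite divr_gt0.
rewrite subr0 normrM normfV normrM normr_nat (gtr0_norm (sqr1_gt0 x)).
rewrite ltr_pdivrMr //.
rewrite -(real_normK (num_real x)); move: xM; rewrite ltr_pdivrMr // => xM.
by have := normr_ge0 x; nra.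
Qed.

End ProjectiveLine.

(** * The choice of the constants *)

Section Constants.
Variables (R : realType) (n : nat).
Hypothesis n2 : (2 <= n)%N.

(** Small enough for the column sums of [eps] to be at most 1/2: consecutive
    lam_i having ratio q, the entries of [eps] are at most 2 q / (1 - q^2). *)
Definition ratio : R := (5 * n%:R)^-1.

(** Decreasing from 1, so that the first index is both the one where lam_i is
    largest and the one where lam_i is 1. *)
Definition geometric_lam (i : 'I_n) : R := ratio ^+ i.

Let nR_gt0 : 0 < n%:R :> R.
Proof. by rewrite ltr0n ltnW. Qed.

Lemma ratio_gt0 : 0 < ratio.
Proof. by rewrite invr_gt0 mulr_gt0. Qed.

Lemma ratio_mul : ratio * n%:R = 5^-1.
Proof. by rewrite /ratio invfM mulfVK // lt0r_neq0. Qed.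

Lemma ratio_le : ratio <= 10^-1.
Proof. by rewrite lef_pV2 ?posrE ?mulr_gt0 // -natrM ler_nat; lia. Qed.

Let ratio_lt1 : ratio < 1.
Proof. by have := ratio_le; lra. Qed.

Lemma geometric_lam_gt0 i : 0 < geometric_lam i.
Proof. by rewrite exprn_gt0 // ratio_gt0. Qed.

Lemma geometric_lam_le1 i : geometric_lam i <= 1.
Proof. by rewrite exprn_ile1 // ?(ltW ratio_gt0) // ltW. Qed.

Lemma geometric_lam_inj : injective geometric_lam.
Proof.
move=> i j /(ieexprIn ratio_gt0) ij; apply/val_inj/ij.
by rewrite lt_eqF.
Qed.

Lemma geometric_eps_small k : \sum_i `|eps geometric_lam i k| <= 2^-1.
Proof.
have r0 := ratio_gt0; have r1 := ratio_le.
have eps_le (i j : 'I_n) : (i < j)%N -> `|eps geometric_lam i j| <= 5 / 2 * ratio.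
  move=> ij; rewrite mxE /geometric_lam -(subnKC (ltnW ij)) exprD.
  have q0 : 0 < ratio ^+ i by rewrite exprn_gt0.
  have s0 : 0 < ratio ^+ (j - i) by rewrite exprn_gt0.
  have s1 : ratio ^+ (j - i) <= ratio.
    by rewrite -subn_gt0 in ij; rewrite -(prednK ij) exprS ler_piMr ?(ltW r0) // exprn_ile1 ?ltW.
  move: (ratio ^+ i) (ratio ^+ (j - i)) q0 s0 s1 => q s q0 s0 s1.
  have d0 : 0 < 1 - s ^+ 2 by nra.
  (* Here q is lam_i and s is lam_j / lam_i. *)
  have -> : 2 * q * (q * s) / (q ^+ 2 - (q * s) ^+ 2) = 2 * s / (1 - s ^+ 2).
    field; rewrite !lt0r_neq0 //=.
    by rewrite (_ : _ - _ = q ^+ 2 * (1 - s ^+ 2)) ?mulr_gt0 ?exprn_gt0 //; ring.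
  rewrite gtr0_norm ?divr_gt0 ?mulr_gt0 // ler_pdivrMr //.
  by nra.
apply: (le_trans (y := \sum_(i < n) 5 / 2 * ratio)).
  apply: ler_sum => i _; case: (ltngtP i k) => ik; first exact: eps_le.
    by rewrite eps_antisym normrN eps_le.
  by rewrite (val_inj ik) eps_diag normr0 mulr_ge0 // ltW.
rewrite sumr_const card_ord -[_ *+ n]mulr_natr -mulrA ratio_mul; lra.
Qed.

Definition tilt_rate : R := ratio ^+ n / 8.

Lemma tilt_rate_gt0 : 0 < tilt_rate.
Proof. by rewrite divr_gt0 // exprn_gt0 // ratio_gt0. Qed.

Lemma tilt_rate_le i : 8 * tilt_rate <= geometric_lam i.
Proof.
rewrite /tilt_rate mulrC divfK // ler_wiXn2l ?(ltW ratio_gt0) ?(ltW ratio_lt1) //.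
exact: ltnW (ltn_ord i).
Qed.

Lemma tilt_rate_sqr : 2 * n%:R * tilt_rate ^+ 2 <= 1.
Proof.
have r0 := ratio_gt0; have r1 := ratio_le.
have rn : 0 < ratio ^+ n by rewrite exprn_gt0.
have rn1 : ratio ^+ n <= ratio.
  by rewrite -(prednK (ltnW n2)) exprS ler_piMr ?(ltW r0) // exprn_ile1 ?ltW.
have := ratio_mul; rewrite /tilt_rate; move: (ratio ^+ n) rn rn1 => s s0 s1 rn5.
have : s * n%:R <= 5^-1 by rewrite -rn5 ler_wpM2r.
nra.
Qed.

End Constants.

(** * The theorem *)

Theorem theorem1p1 (R : realType) (n : nat) (hn : (2 <= n)%N)
    (m : 'rV[R]_n.+1) (hm : sphere m) :
  exists P : one_point_compactification R -> 'M[R]_(n, 2) -> 'rV[R]_n.+1,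
    flexible_cross_polytope P /\
    [/\ exists2 delta : R, 0 < delta &
          forall u : R, - delta < u < delta -> embedded (P (Some u)),
        [/\ simplexwise (P (Some 0)), embedding (P (Some 0)) &
            body (P (Some 0)) = equator m],
        forall u : R,
          (0 < u -> body (P (Some u)) `<=` upper_hemisphere m) /\
          (u < 0 -> body (P (Some u)) `<=` lower_hemisphere m) &
        body (P None) `<=` equator m /\ ~ embedded (P None)].
Proof.
pose lam := geometric_lam R (n := n); pose eta := tilt_rate R n.
have lam0 := geometric_lam_gt0 R hn : forall i, 0 < lam i.
have lam1 := geometric_lam_le1 R hn : forall i, lam i <= 1.
have lamI := @geometric_lam_inj R n hn : injective lam.
have epsS := geometric_eps_small R hn : forall k, \sum_i `|eps lam i k| <= 2^-1.
have eta0 := tilt_rate_gt0 R hn : 0 < eta.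
have etaL := tilt_rate_le R hn : forall i, 8 * eta <= lam i.
have etaN := tilt_rate_sqr R hn : 2 * n%:R * eta ^+ 2 <= 1.
have [F FF Fm] : exists2 F : 'M[R]_n.+1, F *m F^T = 1%:M & lift_height 1 0 *m F = - m.
  apply: exists_orthogonal; last by rewrite dotpNl dotpNr opprK.
  by rewrite dotp_lift_height mulr1 /dotp mul0mx mxE addr0.
have n0 : (0 < n)%N by exact: ltnW.
pose i0 : 'I_n := Ordinal n0.
(* The first index serves both for the overlap at infinity and for telling
   members of the family apart. *)
have lam_i0 : lam i0 = 1 by rewrite /lam /geometric_lam expr0.
pose p (u : one_point_compactification R) := tilted_vertex lam eta F (line_circle u).
have pC (u : one_point_compactification R) : circle (line_circle u) by exact: line_circleP.
have p1 u v : dotp (p u v) (p u v) = 1 by exact: tilted_vertex_unit.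
have ip u : independent (p u) by exact: independent_tilted_vertex.
have vp u : vertices (radial_map (p u)) = p u by exact: vertices_radial_map.
have pS u : body (radial_map (p u)) `<=` @sphere R n by exact: radial_map_sphere.
have pE (u : R) : -1 < u < 1 -> embedding (radial_map (p (Some u))).
  move=> /andP[ul uu]; have u2 : u ^+ 2 < 1 by nra.
  apply: tilted_embedding => //.
  by rewrite /= divr_gt0 ?subr_gt0 ?ltr_wpDr ?sqr_ge0.
have p0 : line_circle (Some 0) = (1, 0) :> R * R.
  by rewrite /= expr0n subr0 addr0 divr1 mulr0 mul0r.
have ht u := body_height lam0 lam1 lamI epsS eta0 etaL etaN FF Fm (pC u).
exists (fun u => radial_map (p u)); split; last first.
  split.
  - exists 1 => // u u1; exists (radial_map (p (Some u))); split=> //.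
      exact: radial_map_simplexwise.
    exact: pE.
  - split; first exact: radial_map_simplexwise.
      by apply: pE; rewrite ltrN10 ltr01.
    by rewrite /p p0; exact: tilted_equator.
  - move=> u; have s0 : 0 < 1 + u ^+ 2 by rewrite ltr_wpDr ?sqr_ge0.
    split=> u0 y yB; (split; first exact: pS yB); have [g g0 ->] := ht _ _ yB.
      by rewrite mulr_gt0 // divr_gt0 // mulr_gt0.
    by rewrite pmulr_llt0 // pmulr_llt0 ?invr_gt0 // pmulr_rlt0.
  - split; last first.
      by apply: (tilted_not_embedded (i := i0) lam0 FF) => k; rewrite lam_i0.
    move=> y yB; split; first exact: pS yB.
    by have [g _ ->] := ht _ _ yB; rewrite mul0r.
split.
- split=> //; apply: continuous_in_subspaceT => -[u x]; rewrite inE => -[_ /= xK].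
  apply: (@continuous_radial_map R n _ (fun ux => p ux.1) snd) => /=.
  + move=> v j; apply: (@continuous_tilted_vertex R n lam eta F lam0 _
      (fun ux => line_circle ux.1) (u, x)) => [ux||].
    * exact: pC.
    * apply: (@continuous_comp _ _ _ fst (fun u => (line_circle u).1)).
        exact: cvg_fst.
      exact: line_circle1_continuous.
    * apply: (@continuous_comp _ _ _ fst (fun u => (line_circle u).2)).
        exact: cvg_fst.
      exact: line_circle2_continuous.
  + move=> i j; apply: (@continuous_comp _ _ _ snd (fun x : 'M[R]_(n, 2) => x i j)).
      exact: cvg_snd.
    exact: continuous_entry.
  + exact: cone_map_neq0.
- rewrite (_ : [set _ | _] = set0) //; apply/seteqP; split=> u //=.
  by apply; exact: tilted_nondegenerate.
- move=> v w vw vwK u1 u2; rewrite /spherical_distance !vp.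
  rewrite (gram_tilted_vertex _ lam0 lamI FF (pC u1) (pC u2)) //; right.
  case: v w vw vwK => [i j] [k l] /= vw /mem_complex/(_ i) vwK.
  apply/eqP => ik; apply: vwK; rewrite !inE -!pair_eqE /= ik eqxx /=.
  move: vw; rewrite ik -pair_eqE /= eqxx /=.
  by case: (ord2E j) => ->; case: (ord2E l) => ->.
- move=> u0; exists setT; first exact: filterT.
  move=> u1 u2 _ _ u12 /(tilted_not_congruent lam0 FF (pC u1) (pC u2) lam_i0).
  by move/line_circle_inj.
Qed.
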